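(* (1) There are exactly $55$ minimal lattice coverings of $\mathbb{Z}^2$ of size at most $6$, all of which are strongly minimal and obtained by refining the trivial covering. Their index structures, with multiplicities, are exactly: Size 1: $(1)$: 1. Size 2: none. Size 3: $(2,2,2)$: 1. Size 4: $(2,2,(4,4))$: 3; $(3,3,3,3)$: 1. Size 5: $(2,(4,4),(4,4))$: 3; $(2,2,(4,(8,8)))$: 6. Size 6: $((4,4),(4,4),(4,4))$: 1; $(2,(4,4),(4,(8,8)))$: 12; $(2,2,((8,8),(8,8)))$: 3; $(2,2,(4,(8,(16,16))))$: 12; $(3,3,3,(9,9,9))$: 4; $(2,2,(6,6,6,6))$: 3; $(3,3,3,(6,6,6))$: 4; $(5,5,5,5,5,5)$: 1. (2) There are exactly $144$ minimal coverings of size $7$, of which $126$ are strongly minimal and $18$ are not. The strongly minimal ones have exactly the index structures, with multiplicities: $((4,4),(4,4),(4,(8,8)))$: 6; $(2,(4,(8,8)),(4,(8,8)))$: 12; $(2,(4,4),((8,8),(8,8)))$: 6; $(2,(4,4),(4,(8,(16,16))))$: 24; $(2,2,((8,8),(8,(16,16))))$: 12; $(2,2,(4,((16,16),(16,16))))$: 6; $(2,2,(4,(8,(16,(32,32)))))$: 24; $(2,(4,4),(6,6,6,6))$: 6; $(2,2,(6,6,6,(12,12)))$: 12; $(3,3,3,(6,6,(12,12)))$: 12; $(2,2,(4,(12,12,12,12)))$: 6. The $18$ that are not strongly minimal all have index sequence $(2,3,3,6,6,6,6)$. (3) There are exactly $724$ minimal coverings of size $8$, of which $550$ are strongly minimal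 and $174$ are not. The strongly minimal ones have exactly the index structures, with multiplicities: $(2,2,(4,(8,(16,(32,(64,64))))))$: 48; $(2,2,(4,(8,((32,32),(32,32)))))$: 12; $(2,2,(4,((16,16),(16,(32,32)))))$: 24; $(2,2,((8,8),(8,(16,(32,32)))))$: 24; $(2,2,((8,8),((16,16),(16,16))))$: 6; $(2,2,((8,(16,16)),(8,(16,16))))$: 12; $(2,(4,4),(4,(8,(16,(32,32)))))$: 48; $(2,(4,4),(4,((16,16),(16,16))))$: 12; $(2,(4,4),((8,8),(8,(16,16))))$: 24; $(2,(4,(8,8)),(4,(8,(16,16))))$: 48; $(2,(4,(8,8)),((8,8),(8,8)))$: 12; $((4,4),(4,4),(4,(8,(16,16))))$: 12; $((4,4),(4,4),((8,8),(8,8)))$: 3; $((4,4),(4,(8,8)),(4,(8,8)))$: 12; $(3,3,3,(9,9,(27,27,27)))$: 12; $(3,3,(9,9,9),(9,9,9))$: 6; $(2,2,(4,(8,(24,24,24,24))))$: 12; $(2,2,(4,(12,12,12,(24,24))))$: 24; $(2,2,(6,6,6,(12,(24,24))))$: 24; $(2,2,(6,6,6,(18,18,18)))$: 12; $(2,2,(6,6,(12,12),(12,12)))$: 18; $(2,2,((8,8),(12,12,12,12)))$: 6; $(2,(4,4),(4,(12,12,12,12)))$: 12; $(2,(4,4),(6,6,6,(12,12)))$: 24; $(2,(4,(8,8)),(6,6,6,6))$: 12; $(3,3,3,(6,6,(12,(24,24))))$: 24; $(3,3,3,(6,(12,12),(12,12)))$: 12; $(3,3,3,(6,6,(18,18,18)))$: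 12; $(3,3,3,(9,9,(18,18,18)))$: 12; $(3,3,(6,6,6),(6,6,6))$: 6; $(3,3,(6,6,6),(9,9,9))$: 12; $((4,4),(4,4),(6,6,6,6))$: 3; $(2,2,(10,10,10,10,10,10))$: 3; $(5,5,5,5,5,(10,10,10))$: 6; $(7,7,7,7,7,7,7,7)$: 1. The $174$ that are not strongly minimal have exactly the index sequences, with multiplicities: $(2,3,6,6,6,6,6,6)$: 12; $(3,3,4,4,6,6,6,6)$: 18; $(2,3,3,6,6,6,12,12)$: 72; $(2,3,3,4,6,6,12,12)$: 72.
   Context: A lattice is a subgroup of $\mathbb{Z}^2$ of finite index; it is cocyclic if $\mathbb{Z}^2/L$ is cyclic. A covering (of $\mathbb{Z}^2$) is a finite collection (set) $\mathcal{C}$ of lattices whose union is $\mathbb{Z}^2$; its size is $|\mathcal{C}|$. The trivial covering is $\{\mathbb{Z}^2\}$. A covering is minimal if it ceases to be a covering whenever any one of its lattices is replaced by a proper sublattice (in particular no proper subset of it is a covering; all its lattices are then cocyclic). A minimal covering is strongly minimal if every primitive vector of $\mathbb{Z}^2$ (vector $(c,d)$ with $\gcd(c,d)=1$) lies in exactly one of its lattices. For a prime $p$, the $p$-descendants of a cocyclic lattice $L$ are the cocyclic lattices $L'\subseteq L$ with $[L:L']=p$ (there are $p$ of them if $p\mid[\mathbb{Z}^2:L]$ and $p+1$ otherwise). A $p$-refinement of a covering by cocyclic lattices is obtained by replacing one lattice in it by all of its $p$-descendants; a refinement is any covering obtained by a finite sequence (possibly empty) of $p$-refinements, the prime $p$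 being allowed to vary from step to step. Index structures (for refinements of the trivial covering): a number $N$ (or $(N)$) denotes a cocyclic lattice of index $N$ belonging to the covering. A bracketed list denotes a cocyclic lattice that has been replaced by all its $p$-descendants for some prime $p$, the entries of the list (in any order) describing what has been done with each of these descendants (each being either kept, and denoted by its index, or itself refined, and denoted by a bracketed list). The outermost bracket corresponds to $\mathbb{Z}^2$ itself, and the trivial covering is $(1)$. For example $(2,2,(4,4))$ denotes a covering obtained by replacing $\mathbb{Z}^2$ by the three lattices of index 2 and then replacing one of these by its two $2$-descendants. The multiplicity of an index structure is the number of distinct coverings having that structure. For the coverings that are not strongly minimal, the index sequence is the multiset of indices of its lattices, and the multiplicity is the number of minimal, not strongly minimal coverings with that index sequence. *)

(* Defs.v *)
From mathcomp Require Import all_boot all_algebra.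
From mathcomp Require Import boolp classical_sets functions cardinality.
From Stdlib Require List Permutation Relation_Operators.

Set Implicit Arguments.
Unset Strict Implicit.
Unset Printing Implicit Defensive.

Import GRing.Theory.
Local Open Scope classical_set_scope.
Local Open Scope card_scope.

Notation Z2 := (int * int)%type.

Definition cosets (H L : set Z2) : set (set Z2) :=
  [set [set (v + l)%R | l in L] | v in H].

(* [H : L] = n, for L a subgroup of H. *)
Definition index_is (H L : set Z2) (n : nat) : Prop := cosets H L #= `I_n.

Definition lattice (L : set Z2) : Prop :=
  zmod_closed [in L] /\ finite_set (cosets setT L).

(* Z^2 / L is generated by the class of g. *)
Definition cocyclic (L : set Z2) : Prop :=
  lattice L /\ exists g : Z2, forall v : Z2, exists k : int, L (v - g *~ k)%R.

Definition covering (C : set (set Z2)) : Prop :=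
  [/\ finite_set C, C `<=` lattice & \bigcup_(L in C) L = setT].

Definition trivial_covering : set (set Z2) := [set setT].

Definition minimal (C : set (set Z2)) : Prop :=
  covering C /\
  forall L L' : set Z2, C L -> lattice L' -> L' `<` L ->
    ~ covering (L' |` (C `\ L)).

Definition primitive (v : Z2) : Prop := coprimez v.1 v.2.

Definition strongly_minimal (C : set (set Z2)) : Prop :=
  minimal C /\
  forall v : Z2, primitive v -> exists! L : set Z2, C L /\ L v.

Definition descendants (p : nat) (L : set Z2) : set (set Z2) :=
  [set L' | [/\ cocyclic L', L' `<=` L & index_is L L' p]].

Definition p_refinement (p : nat) (C C' : set (set Z2)) : Prop :=
  [/\ covering C, C `<=` cocyclic &
      exists2 L, C L & C' = (C `\ L) `|` descendants p L].

Definition refinement : set (set Z2) -> set (set Z2) -> Prop :=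
  Relation_Operators.clos_refl_trans _
    (fun C C' => exists2 p, prime p & p_refinement p C C').

(* [Kept N] is an entry N and [Refined ss] a bracketed list.  The lattice Z^2
   itself, when kept, is [Kept 1], so the structure (1) is [Kept 1]. *)
Inductive istruct : Type :=
| Kept of nat
| Refined of seq istruct.

Coercion Kept : nat >-> istruct.

Notation "<( x , .. , y )>" :=
  (Refined (@cons istruct x .. (@cons istruct y (@nil istruct)) ..))
  (at level 0, x at level 99, y at level 99).

(* Equality of index structures up to the order of the entries, at all
   levels. *)
Inductive same_struct : istruct -> istruct -> Prop :=
| same_kept N : same_struct (Kept N) (Kept N)
| same_refined ss ss' ss'' :
    Permutation.Permutation ss ss' -> List.Forall2 same_struct ss' ss'' ->
    same_struct (Refined ss) (Refined ss'').

Definition enumerates (s : seq (set Z2)) (A : set (set Z2)) : Prop :=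
  uniq s /\ [set` s] = A.

(* [realizes s L C]: the lattices in C are those obtained from L by the
   refinements described by s. *)
Inductive realizes : istruct -> set Z2 -> set (set Z2) -> Prop :=
| realizes_kept N L :
    cocyclic L -> index_is setT L N -> realizes (Kept N) L [set L]
| realizes_refined p ss Ds L C :
    prime p -> cocyclic L -> enumerates Ds (descendants p L) ->
    realizes_all ss Ds C -> realizes (Refined ss) L C
with realizes_all : seq istruct -> seq (set Z2) -> set (set Z2) -> Prop :=
| realizes_nil : realizes_all [::] [::] set0
| realizes_cons s ss D Ds C C' :
    realizes s D C -> realizes_all ss Ds C' ->
    realizes_all (s :: ss) (D :: Ds) (C `|` C').

Definition has_structure (s : istruct) (C : set (set Z2)) : Prop :=
  covering C /\ realizes s setT C.

Definition has_index_sequence (t : seq nat) (C : set (set Z2)) : Prop :=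
  exists2 Ls, enumerates Ls C & List.Forall2 (index_is setT) Ls t.

(* Every covering in the family F has an index structure; the index structures
   occurring in F are, up to order, exactly those in T; and each of them has
   the multiplicity listed in T. *)
Definition classified_by_structure (F : set (set (set Z2)))
    (T : seq (istruct * nat)) : Prop :=
  [/\ forall C, F C -> exists s, has_structure s C,
      forall s, (exists2 C, F C & has_structure s C) <->
                (exists2 e, List.In e T & same_struct s e.1)
    & forall e, List.In e T -> [set C | has_structure e.1 C] #= `I_(e.2)].

(* Likewise for index sequences, where multiplicities count members of F. *)
Definition classified_by_indices (F : set (set (set Z2)))
    (T : seq (seq nat * nat)) : Prop :=
  [/\ forall C, F C -> exists t, has_index_sequence t C,
      forall t, (exists2 C, F C & has_index_sequence t C) <->
                (exists2 e, e \in T & perm_eq t e.1)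
    & forall e, e \in T ->
        [set C | F C /\ has_index_sequence e.1 C] #= `I_(e.2)].

Definition minimal_of_size (n : nat) : set (set (set Z2)) :=
  [set C | minimal C /\ C #= `I_n].

Definition strongly_minimal_of_size (n : nat) : set (set (set Z2)) :=
  [set C | strongly_minimal C /\ C #= `I_n].

Definition not_strongly_minimal_of_size (n : nat) : set (set (set Z2)) :=
  [set C | [/\ minimal C, ~ strongly_minimal C & C #= `I_n]].

Definition structures_up_to_6 (n : nat) : seq (istruct * nat) :=
  match n with
  | 1 => [::
   (Kept 1, 1)]
  | 3 => [::
   (<(2, 2, 2)>, 1)]
  | 4 => [::
   (<(2, 2, <(4, 4)>)>, 3);
   (<(3, 3, 3, 3)>, 1)]
  | 5 => [::
   (<(2, <(4, 4)>, <(4, 4)>)>, 3);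
   (<(2, 2, <(4, <(8, 8)>)>)>, 6)]
  | 6 => [::
   (<(<(4, 4)>, <(4, 4)>, <(4, 4)>)>, 1);
   (<(2, <(4, 4)>, <(4, <(8, 8)>)>)>, 12);
   (<(2, 2, <(<(8, 8)>, <(8, 8)>)>)>, 3);
   (<(2, 2, <(4, <(8, <(16, 16)>)>)>)>, 12);
   (<(3, 3, 3, <(9, 9, 9)>)>, 4);
   (<(2, 2, <(6, 6, 6, 6)>)>, 3);
   (<(3, 3, 3, <(6, 6, 6)>)>, 4);
   (<(5, 5, 5, 5, 5, 5)>, 1)]
  | _ => [::]
  end.

Definition structures_7 : seq (istruct * nat) := [::
   (<(<(4, 4)>, <(4, 4)>, <(4, <(8, 8)>)>)>, 6);
   (<(2, <(4, <(8, 8)>)>, <(4, <(8, 8)>)>)>, 12);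
   (<(2, <(4, 4)>, <(<(8, 8)>, <(8, 8)>)>)>, 6);
   (<(2, <(4, 4)>, <(4, <(8, <(16, 16)>)>)>)>, 24);
   (<(2, 2, <(<(8, 8)>, <(8, <(16, 16)>)>)>)>, 12);
   (<(2, 2, <(4, <(<(16, 16)>, <(16, 16)>)>)>)>, 6);
   (<(2, 2, <(4, <(8, <(16, <(32, 32)>)>)>)>)>, 24);
   (<(2, <(4, 4)>, <(6, 6, 6, 6)>)>, 6);
   (<(2, 2, <(6, 6, 6, <(12, 12)>)>)>, 12);
   (<(3, 3, 3, <(6, 6, <(12, 12)>)>)>, 12);
   (<(2, 2, <(4, <(12, 12, 12, 12)>)>)>, 6)].

Definition structures_8 : seq (istruct * nat) := [::
   (<(2, 2, <(4, <(8, <(16, <(32, <(64, 64)>)>)>)>)>)>, 48);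
   (<(2, 2, <(4, <(8, <(<(32, 32)>, <(32, 32)>)>)>)>)>, 12);
   (<(2, 2, <(4, <(<(16, 16)>, <(16, <(32, 32)>)>)>)>)>, 24);
   (<(2, 2, <(<(8, 8)>, <(8, <(16, <(32, 32)>)>)>)>)>, 24);
   (<(2, 2, <(<(8, 8)>, <(<(16, 16)>, <(16, 16)>)>)>)>, 6);
   (<(2, 2, <(<(8, <(16, 16)>)>, <(8, <(16, 16)>)>)>)>, 12);
   (<(2, <(4, 4)>, <(4, <(8, <(16, <(32, 32)>)>)>)>)>, 48);
   (<(2, <(4, 4)>, <(4, <(<(16, 16)>, <(16, 16)>)>)>)>, 12);
   (<(2, <(4, 4)>, <(<(8, 8)>, <(8, <(16, 16)>)>)>)>, 24);
   (<(2, <(4, <(8, 8)>)>, <(4, <(8, <(16, 16)>)>)>)>, 48);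
   (<(2, <(4, <(8, 8)>)>, <(<(8, 8)>, <(8, 8)>)>)>, 12);
   (<(<(4, 4)>, <(4, 4)>, <(4, <(8, <(16, 16)>)>)>)>, 12);
   (<(<(4, 4)>, <(4, 4)>, <(<(8, 8)>, <(8, 8)>)>)>, 3);
   (<(<(4, 4)>, <(4, <(8, 8)>)>, <(4, <(8, 8)>)>)>, 12);
   (<(3, 3, 3, <(9, 9, <(27, 27, 27)>)>)>, 12);
   (<(3, 3, <(9, 9, 9)>, <(9, 9, 9)>)>, 6);
   (<(2, 2, <(4, <(8, <(24, 24, 24, 24)>)>)>)>, 12);
   (<(2, 2, <(4, <(12, 12, 12, <(24, 24)>)>)>)>, 24);
   (<(2, 2, <(6, 6, 6, <(12, <(24, 24)>)>)>)>, 24);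
   (<(2, 2, <(6, 6, 6, <(18, 18, 18)>)>)>, 12);
   (<(2, 2, <(6, 6, <(12, 12)>, <(12, 12)>)>)>, 18);
   (<(2, 2, <(<(8, 8)>, <(12, 12, 12, 12)>)>)>, 6);
   (<(2, <(4, 4)>, <(4, <(12, 12, 12, 12)>)>)>, 12);
   (<(2, <(4, 4)>, <(6, 6, 6, <(12, 12)>)>)>, 24);
   (<(2, <(4, <(8, 8)>)>, <(6, 6, 6, 6)>)>, 12);
   (<(3, 3, 3, <(6, 6, <(12, <(24, 24)>)>)>)>, 24);
   (<(3, 3, 3, <(6, <(12, 12)>, <(12, 12)>)>)>, 12);
   (<(3, 3, 3, <(6, 6, <(18, 18, 18)>)>)>, 12);
   (<(3, 3, 3, <(9, 9, <(18, 18, 18)>)>)>, 12);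
   (<(3, 3, <(6, 6, 6)>, <(6, 6, 6)>)>, 6);
   (<(3, 3, <(6, 6, 6)>, <(9, 9, 9)>)>, 12);
   (<(<(4, 4)>, <(4, 4)>, <(6, 6, 6, 6)>)>, 3);
   (<(2, 2, <(10, 10, 10, 10, 10, 10)>)>, 3);
   (<(5, 5, 5, 5, 5, <(10, 10, 10)>)>, 6);
   (<(7, 7, 7, 7, 7, 7, 7, 7)>, 1)].

Definition index_sequences_7 : seq (seq nat * nat) :=
  [:: ([:: 2; 3; 3; 6; 6; 6; 6], 18)].

Definition index_sequences_8 : seq (seq nat * nat) := [::
   ([:: 2; 3; 6; 6; 6; 6; 6; 6], 12);
   ([:: 3; 3; 4; 4; 6; 6; 6; 6], 18);
   ([:: 2; 3; 3; 6; 6; 6; 12; 12], 72);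
   ([:: 2; 3; 3; 4; 6; 6; 12; 12], 72)].

(* Main.v *)
(* Every cocyclic lattice is Lam n v = {w : n divides det(v, w)} for a primitive v,
   so that a minimal covering is an irredundant covering of P^1(Z/m) by residue
   classes, m being the lcm of the indices.  Simpson's bound for such coverings,
   |C| >= 1 + sum of (k (p - 1) + 1) over the prime powers p^k exactly dividing m,
   shows that for |C| <= 8 the number m divides 7, 10, 18, 24, 27 or 64.  For each
   of these moduli all minimal coverings are found by covering the first uncovered
   point in all possible ways, giving up a branch as soon as the points covered by
   only one of the chosen lattices lie in a proper sublattice of it.  A covering
   that realizes an index structure is an exact tiling, and its structure is
   unique because at each lattice that is refined only one prime divides all the
   relative indices. *)
From Stdlib Require Import NArith.
Require Import Defs.
From mathcomp Require Import all_boot all_algebra.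
From mathcomp Require Import ring zify.

Set Implicit Arguments.
Unset Strict Implicit.
Unset Printing Implicit Defensive.

(** * Hall's theorem *)

(** Only primitive vectors matter: every vector is a multiple of one, and on primitive vectors
    membership in [Lam n v] is an equivalence relation. The obstacle is that nothing bounds the
    indices in a covering of given size beforehand; Simpson's bound does. With at most 8 lattices
    its sum over prime powers is at most 7, and the six moduli are the maximal ones allowed, each
    attaining 7: for instance 2 + 5 for 10 and 4 + 3 for 24. Giving up a branch is safe because the
    points covered by only one chosen lattice can only become fewer as lattices are added. A
    covering turns up under several moduli, so each lattice gets a representative that depends on
    the lattice alone, and a covering becomes a strictly sorted list. The search is proved both
    complete and sound, so one computed list names every minimal covering of size at most 8 exactly
    once, and all multiplicities are counts in that list. *)

Lemma hall (T S : finType) (s0 : S) (e : T -> {set S}) (A : {set T}) :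
  (forall H : {set T}, H \subset A -> #|H| <= #|\bigcup_(x in H) e x|) ->
  exists f : T -> S, {in A &, injective f} /\ {in A, forall x, f x \in e x}.
Proof.
have [n] := ubnP #|A|; elim: n e A => // n IH e A /ltnSE leAn hA.
case: (set_0Vmem A) => [->|[a aA]].
  by exists (fun=> s0); split=> x; rewrite inE.
(* Either some nonempty proper subset is tight and is matched separately from the rest, or every
   such subset has a spare neighbour and one element may be matched at will. *)
case: (boolP [exists H : {set T}, [&& H \subset A, H != set0, H != A &
    #|\bigcup_(x in H) e x| <= #|H|]]).
- case/existsP=> H /and4P[HA H0 HnA tight].
  have ltH : #|H| < #|A| by rewrite proper_card // properEneq HnA.
  have ltD : #|A :\: H| < #|A|.
    rewrite proper_card // properE subsetDl /=; apply/negP => AD.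
    case/set0Pn: H0 => x xH; have := subsetP AD x (subsetP HA x xH).
    by rewrite inE xH.
  have [|g [gi gE]] := IH e H (leq_trans ltH leAn).
    by move=> K KH; apply: hA; apply: subset_trans KH HA.
  (* The neighbours of the tight [H] are withdrawn. Hall's condition for [K] follows from that for
     [H :|: K], because [H] accounts for at most [#|H|] of the neighbours. *)
  pose e' x := e x :\: \bigcup_(y in H) e y.
  have [|h [hi hE]] := IH e' (A :\: H) (leq_trans ltD leAn).
    move=> K KD; have [KA KH] : K \subset A /\ [disjoint K & H].
      by move: KD; rewrite subsetD => /andP[].
    have -> : \bigcup_(x in K) e' x = (\bigcup_(x in H :|: K) e x) :\: \bigcup_(y in H) e y.
      apply/setP=> s; rewrite !inE; apply/bigcupP/andP.
        case=> x xK; rewrite !inE => /andP[sH sx]; split=> //.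
        by apply/bigcupP; exists x; rewrite // inE xK orbT.
      case=> sH /bigcupP[x]; rewrite inE => /orP[xH|xK] sx.
        by case/negP: sH; apply/bigcupP; exists x.
      by exists x; rewrite // !inE sH.
    have sub : \bigcup_(x in H) e x \subset \bigcup_(x in H :|: K) e x.
      by apply/bigcupsP=> x xH; apply: bigcup_sup; rewrite inE xH.
    rewrite cardsD (setIidPr sub).
    have := hA (H :|: K); rewrite subUset HA KA => /(_ isT).
    rewrite cardsU disjoint_setI0 1?disjoint_sym // cards0 subn0.
    by move=> h1; rewrite leq_subRL ?subset_leq_card //; lia.
  exists (fun x => if x \in H then g x else h x); split=> x.
    have sep y z : y \in H -> z \in A :\: H -> g y <> h z.
      move=> yH zD eq; have := hE z zD; rewrite inE -eq => /andP[/negP nb _].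
      by apply: nb; apply/bigcupP; exists y => //; apply: gE.
    move=> y xA yA; case: ifPn => xH; case: ifPn => yH.
    - exact: gi.
    - by move/sep; case=> //; rewrite inE yH.
    - by move/esym/sep; case=> //; rewrite inE xH.
    - by apply: hi; rewrite inE ?xH ?yH.
  move=> xA; case: ifPn => xH; first exact: gE.
  have : h x \in e' x by apply: hE; rewrite inE xH.
  by rewrite inE => /andP[].
(* Removing [a] and its partner [s] costs each [K] at most one neighbour, which the strict
   inequality from [ntight] affords. *)
- move=> /existsPn ntight.
  have : #|[set a]| <= #|\bigcup_(x in [set a]) e x| by apply: hA; rewrite sub1set.
  rewrite big_set1 cards1 => /card_gt0P[s sa].
  pose e' x := e x :\ s.
  have [||g [gi gE]] := IH e' (A :\ a).
  + by rewrite [#|A|](cardsD1 a) aA in leAn.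
  + move=> K KA; case: (eqVneq K set0) => [->|K0]; first by rewrite cards0.
    have KsA : K \subset A by apply: subset_trans KA (subD1set _ _).
    have KnA : K != A.
      by apply: contraTneq KA => ->; apply/negP=> /subsetP/(_ a aA); rewrite !inE eqxx.
    have := ntight K; rewrite KsA K0 KnA /= -ltnNge => lt.
    have -> : \bigcup_(x in K) e' x = (\bigcup_(x in K) e x) :\ s.
      apply/setP=> t; rewrite !inE; apply/bigcupP/andP.
        by case=> x xK; rewrite !inE => /andP[ts tx]; split=> //; apply/bigcupP; exists x.
      by case=> ts /bigcupP[x xK tx]; exists x; rewrite // !inE ts.
    have := cardsD1 s (\bigcup_(x in K) e x).
    by case: (s \in _) => /=; lia.
  exists (fun x => if x == a then s else g x); split=> x.
    have ng y : y \in A -> y != a -> g y <> s.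
      by move=> yA ya eq; have := gE y; rewrite !inE ya yA eq eqxx => /(_ isT).
    move=> y xA yA; case: eqP => [->|/eqP xa]; case: eqP => [->|/eqP ya] //.
    - move=> eq; case: (ng _ yA ya (esym eq)).
    - move=> eq; case: (ng _ xA xa eq).
    - by apply: gi; rewrite !inE ?xa ?ya ?xA ?yA.
  move=> xA; case: eqP => [->//|/eqP xa].
  by have := gE x; rewrite !inE xa xA => /(_ isT) /andP[].
Qed.

From mathcomp Require Import boolp classical_sets functions cardinality.
Import GRing.Theory.
Local Open Scope classical_set_scope.
Local Open Scope card_scope.
Local Open Scope ring_scope.

Lemma card_eq_seq (T : eqType) (s : seq T) (n : nat) :
  uniq s -> ([set` s] #= `I_n) = (size s == n).
Proof.
move=> us; suff h : [set` s] #= `I_(size s).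
  apply/idP/eqP => [h'|<-//]; apply/card_eq_II.
  by apply: card_eq_trans h'; rewrite card_eq_sym.
elim: s us => [_|x s IH /= /andP[xs us]].
  by rewrite set_nil II0.
apply/eq_cardSP; exists x; first by rewrite /= mem_head.
rewrite (_ : _ `\ x = [set` s]); first exact: IH.
apply/seteqP; split=> y /=.
  by case; rewrite inE => /orP[/eqP->|].
move=> ys; split; first by rewrite inE ys orbT.
by move=> e; rewrite -e ys in xs.
Qed.

(** * Cocyclic lattices and coverings *)

Definition det (v w : Z2) : int := v.1 * w.2 - v.2 * w.1.

(* For primitive [v], the cocyclic lattice [Z v + n Z^2] of index [n]. *)
Definition Lam (n : nat) (v : Z2) : set Z2 := [set w | (n%:Z %| det v w)%Z].

Lemma det_refl v : det v v = 0. Proof. rewrite /det; ring. Qed.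
Lemma det_opp v w : det w v = - det v w. Proof. rewrite /det; ring. Qed.

Lemma detDr v x y : det v (x + y) = det v x + det v y.
Proof. case: x y => [a b] [c d]; rewrite /det /=; ring. Qed.
Lemma detNr v x : det v (- x) = - det v x.
Proof. case: x => [a b]; rewrite /det /=; ring. Qed.
Lemma detBr v x y : det v (x - y) = det v x - det v y.
Proof. by rewrite detDr detNr. Qed.
Lemma pairMz (x : Z2) (k : int) : x *~ k = (x.1 * k, x.2 * k).
Proof.
case: x => a b; have f1 := raddfMz (@fst int int) k (a, b).
have f2 := raddfMz (@snd int int) k (a, b).
rewrite [LHS]surjective_pairing f1 f2 /=; congr (_, _); exact: mulrzz.
Qed.
Lemma detMr v x k : det v (x *~ k) = det v x * k.
Proof. rewrite pairMz /det /=; ring. Qed.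

Lemma Lam_sym n v w : Lam n v w -> Lam n w v.
Proof. by rewrite /Lam /= det_opp rpredN. Qed.
Lemma Lam_refl n v : Lam n v v. Proof. by rewrite /Lam /= det_refl dvdz0. Qed.
Lemma Lam0 n v : Lam n v 0.
Proof. by rewrite /Lam /= /det /= !mulr0 subrr dvdz0. Qed.
Lemma LamB n v x y : Lam n v x -> Lam n v y -> Lam n v (x - y).
Proof. by rewrite /Lam /= detBr => hx hy; rewrite rpredB. Qed.
Lemma Lam1 v : Lam 1 v = setT.
Proof. by apply/seteqP; split=> // x _; rewrite /Lam /= dvd1z. Qed.

Lemma primitive_basis v : primitive v -> exists u, det v u = 1.
Proof.
move/coprimezP => [[a b] /= e]; exists (- b, a); rewrite /det /= -e; ring.
Qed.
Lemma basis_primitive v u : det v u = 1 -> primitive v.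
Proof.
by move=> e; apply/coprimezP; exists (u.2, - u.1) => /=; rewrite -e /det; ring.
Qed.
(** Cramer's rule in the basis [v], [u]: membership of [x] in [Lam n v] is a condition on its
    [u]-coordinate [det v x] alone. *)
Lemma basis_expand v u x : det v u = 1 -> x = v *~ (- det u x) + u *~ det v x.
Proof.
move=> e; rewrite !pairMz; case: v u x e => [a b] [c d] [x y]; rewrite /det /= => e.
rewrite -[LHS]/(x, y) -[RHS]/(a * _ + c * _, b * _ + d * _).
congr (_, _).
  by rewrite -[LHS]mul1r -e; ring.
by rewrite -[LHS]mul1r -e; ring.
Qed.

Lemma primitive_multiple (x : Z2) : exists v k, primitive v /\ x = v *~ k.
Proof.
case: (eqVneq x 0) => [->|nz].
  by exists (1, 0), 0; split=> //; rewrite /primitive /= coprime1z.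
have [u [v e]] := Bezoutz x.1 x.2.
set g := gcdz _ _ in e.
have g0 : g != 0.
  apply: contraNneq nz => /eqP; rewrite gcdz_eq0 => /andP[/eqP a /eqP b].
  by rewrite (surjective_pairing x) a b.
exists ((x.1 %/ g)%Z, (x.2 %/ g)%Z), g.
have h1 : ((x.1 %/ g)%Z * g = x.1) by rewrite divzK // dvdz_gcdl.
have h2 : ((x.2 %/ g)%Z * g = x.2) by rewrite divzK // dvdz_gcdr.
split; last by rewrite pairMz /= h1 h2 -surjective_pairing.
apply/coprimezP; exists (u, v) => /=; apply: (mulIf g0).
by rewrite mulrDl mul1r -!mulrA h1 h2.
Qed.

(** Expanding [x] in a basis that contains [w] makes [det v x] a combination of [det v w] and
    [det w x]. Together with [Lam_sym] and [Lam_refl], this identifies the classes of primitive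
    vectors with the points of P^1(Z/n). *)
Lemma Lam_trans n v w x : primitive w -> Lam n v w -> Lam n w x -> Lam n v x.
Proof.
rewrite /Lam /= => /primitive_basis[u e] h1 h2.
rewrite [x](basis_expand _ e) detDr !detMr rpredD //.
  by rewrite dvdz_mulr.
by rewrite dvdz_mull.
Qed.

Lemma Lam_eq n v w : primitive v -> primitive w -> Lam n v w -> Lam n v = Lam n w.
Proof.
move=> pv pw h; apply/seteqP; split=> x; apply: Lam_trans => //.
exact: Lam_sym.
Qed.

Lemma Lam_dvd m n v : (m %| n)%N -> Lam n v `<=` Lam m v.
Proof. by move=> h x; rewrite /Lam /=; apply: dvdz_trans. Qed.

Lemma Lam_sub n m v w : (m %| n)%N -> primitive v -> Lam m w v ->
  Lam n v `<=` Lam m w.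
Proof.
by move=> mn pv h x /(Lam_dvd mn); apply: Lam_trans.
Qed.

Lemma Lam_subP n m v w : primitive v -> primitive w -> Lam n v `<=` Lam m w ->
  (m %| n)%N /\ Lam m w v.
Proof.
move=> pv pw h; have hv : Lam m w v by apply/h/Lam_refl.
split=> //; rewrite (Lam_eq pw pv hv) in h.
have [u e] := primitive_basis pv.
have /h : Lam n v (u *~ n) by rewrite /Lam /= detMr e mul1r dvdzz.
by rewrite /Lam /= detMr e mul1r.
Qed.

Lemma Lam_inj n m v w : primitive v -> primitive w -> Lam n v = Lam m w ->
  n = m /\ Lam n v w.
Proof.
move=> pv pw e.
have [h1 _] : (m %| n)%N /\ Lam m w v by apply: Lam_subP; rewrite ?e.
have [h2 _] : (n %| m)%N /\ Lam n v w by apply: Lam_subP; rewrite ?e.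
by split; [apply/eqP; rewrite eqn_dvd h1 h2 | rewrite e; apply: Lam_refl].
Qed.

(** * Cosets and indices *)

Definition coset (L : set Z2) (v : Z2) : set Z2 := [set v + l | l in L].

Lemma coset_eq (L : set Z2) v w : L 0 -> (forall x y, L x -> L y -> L (x - y)) ->
  (coset L v = coset L w) <-> L (v - w).
Proof.
move=> L0 LB.
have LN x : L x -> L (- x) by move=> h; rewrite -[- x]add0r; apply: LB.
have LD x y : L x -> L y -> L (x + y).
  by move=> hx hy; rewrite -[y]opprK; apply: LB => //; apply: LN.
split.
  move=> e; have : coset L v v by exists 0; rewrite ?addr0.
  by rewrite e => -[l hl <-]; rewrite addrC addKr.
move=> h; apply/seteqP; split=> x [l hl <-].
  exists (v - w + l); first exact: LD.
  by rewrite addrA addrCA subrr addr0.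
exists (- (v - w) + l); first by apply: LD => //; apply: LN.
by rewrite opprB addrA addrCA subrr addr0.
Qed.

Lemma latticeP L : lattice L <->
  [/\ L 0, forall x y, L x -> L y -> L (x - y) & finite_set (cosets setT L)].
Proof.
split.
  case=> -[h0 hB] hf; split=> //; first by move: h0; rewrite inE.
  by move=> x y hx hy; have := hB x y; rewrite !inE; apply.
case=> h0 hB hf; split=> //; split; first by rewrite inE.
by move=> x y; rewrite !inE; apply: hB.
Qed.

Lemma lattice_sub L x y : lattice L -> L x -> L y -> L (x - y).
Proof. by move=> /latticeP[_ hB _]; apply: hB. Qed.
Lemma lattice_opp L x : lattice L -> L x -> L (- x).
Proof. by move=> /latticeP[h0 hB _] hx; rewrite -[- x]add0r; apply: hB. Qed.
Lemma lattice_add L x y : lattice L -> L x -> L y -> L (x + y).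
Proof.
move=> lL hx hy; have /latticeP[_ hB _] := lL.
by rewrite -[y]opprK; apply: hB => //; apply: lattice_opp.
Qed.
Lemma lattice_mulz L x (k : int) : lattice L -> L x -> L (x *~ k).
Proof.
move=> lL hx; have h n : L (x *+ n).
  elim: n => [|n IH]; first by rewrite mulr0n; case/latticeP: lL.
  by rewrite mulrS; apply: lattice_add.
case: k => n; first exact: h.
by apply: lattice_opp.
Qed.

(** If [det w u = 1], the multiples [n k u] with [k < m] represent the cosets, one each, because a
    coset is determined by the value of [det w] modulo [n * m]. *)
Lemma index_Lam n m w : (0 < n)%N -> (0 < m)%N -> primitive w ->
  index_is (Lam n w) (Lam (n * m) w) m.
Proof.
move=> n0 m0 pw; have [u e] := primitive_basis pw.
pose f k := coset (Lam (n * m) w) (u *~ (n%:Z * k%:Z)).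
have Lc x y : coset (Lam (n * m) w) x = coset (Lam (n * m) w) y <->
   Lam (n * m) w (x - y).
  by apply: coset_eq; [apply: Lam0 | move=> *; apply: LamB].
have du (a : int) : det w (u *~ a) = a by rewrite detMr e mul1r.
rewrite /index_is (_ : cosets _ _ = [set` [seq f k | k <- iota 0 m]]).
  rewrite card_eq_seq ?size_map ?size_iota // map_inj_in_uniq ?iota_uniq //.
  move=> i j; rewrite !mem_iota /= !add0n => hi hj /Lc.
  rewrite /Lam /= detBr !du -mulrBr PoszM dvdz_mul2l ?eqz_nat -?lt0n //.
  rewrite -eqz_mod_dvd !modz_small ?ltz_nat ?hi ?hj //; first by move/eqP => [].
apply/seteqP; split=> X /=.
  case=> v hv <-; have hv' := hv; case/dvdzP: hv' => q hq.
  have m0' : m%:Z != 0 by rewrite eqz_nat -lt0n.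
  have := modz_ge0 q m0'; have := ltz_pmod q (_ : 0 < m%:Z).
  rewrite ltz_nat m0 => /(_ isT); case E : (q %% m)%Z => [k|//] hk _.
  apply/mapP; exists k; first by rewrite mem_iota /= add0n -ltz_nat.
  apply/Lc; rewrite /Lam /= detBr du hq mulrC -mulrBr PoszM.
  by rewrite dvdz_mul2l ?eqz_nat -?lt0n // -E -eqz_mod_dvd modz_mod.
move/mapP => [k _ ->]; exists (u *~ (n%:Z * k%:Z)) => //.
by rewrite /Lam /= du dvdz_mulr.
Qed.

Lemma index_LamP n m v w p : (0 < n)%N -> (0 < m)%N -> primitive v -> primitive w ->
  Lam m w `<=` Lam n v -> index_is (Lam n v) (Lam m w) p <-> m = (n * p)%N.
Proof.
move=> n0 m0 pv pw /(Lam_subP pw pv)[/dvdnP[q e] h].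
have q0 : (0 < q)%N by move: m0; rewrite e muln_gt0 => /andP[].
have := index_Lam n0 q0 pw; rewrite mulnC -e -(Lam_eq pv pw h) /index_is => hq.
split=> [hp|].
  have /card_eq_II -> : `I_p #= `I_q by apply: card_eq_trans hq; rewrite card_eq_sym.
  by rewrite mulnC.
by move=> hp; suff <- : q = p by []; apply/eqP; rewrite -(eqn_pmul2l n0) mulnC -e hp.
Qed.

Lemma index_LamT n v N : (0 < n)%N -> primitive v ->
  index_is setT (Lam n v) N <-> n = N.
Proof.
move=> n0 pv; rewrite -(Lam1 v) index_LamP ?mul1n //.
by rewrite Lam1.
Qed.

Lemma lattice_Lam n v : (0 < n)%N -> primitive v -> lattice (Lam n v).
Proof.
move=> n0 pv; apply/latticeP; split; [exact: Lam0 | exact: LamB | ].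
by apply/finite_setP; exists n; apply/(index_LamT _ n0 pv).
Qed.

Lemma cocyclic_Lam n v : (0 < n)%N -> primitive v -> cocyclic (Lam n v).
Proof.
move=> n0 pv; split; first exact: lattice_Lam.
have [u e] := primitive_basis pv; exists u => x; exists (det v x).
by rewrite /Lam /= detBr detMr e mul1r subrr dvdz0.
Qed.

(** * Lattices that contain a primitive vector *)

Lemma lattice_torsion L u : lattice L -> exists2 n, (0 < n)%N & L (u *~ n%:Z).
Proof.
move=> /latticeP[h0 hB hf]; apply: contrapT => h.
pose f (k : nat) := coset L (u *~ k%:Z).
have fi : injective f.
  have ne i j : (i < j)%N -> f j <> f i.
    move=> ij /(coset_eq _ _ h0 hB) hL; apply: h; exists (j - i)%N.
      by rewrite subn_gt0.
    by rewrite -subzn 1?ltnW // mulrzBr.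
  move=> i j e; case: (ltngtP i j) => // ij; first by case: (ne _ _ ij).
  by case: (ne _ _ ij).
apply: infinite_nat; rewrite (_ : [set: nat] = f @^-1` (cosets setT L)).
  by apply: finite_preimage => // x y _ _ /fi.
by apply/seteqP; split=> // k _; exists (u *~ k%:Z).
Qed.

(** In a basis [v], [u], the multiples of [u] lying in [L] are those of a least positive one, [n u].
    Since [L] contains all multiples of [v], the [u]-coordinate alone decides membership. *)
Lemma lattice_primitive L v : lattice L -> primitive v -> L v ->
  exists2 n, (0 < n)%N & L = Lam n v.
Proof.
move=> lL pv hv; have [u e] := primitive_basis pv.
have [n0 n00 hn0] := lattice_torsion u lL.
have ex : exists n, (0 < n)%N && `[< L (u *~ n%:Z) >].
  by exists n0; rewrite n00 /=; apply/asboolP.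
case: (ex_minnP ex) => m /andP[m0 /asboolP hm] mmin; exists m => //.
apply/seteqP; split=> x.
  move=> hx; have hu : L (u *~ det v x).
    have -> : u *~ det v x = x - v *~ (- det u x).
      by rewrite {2}(basis_expand x e) addrAC subrr add0r.
    by apply: lattice_sub => //; apply: lattice_mulz.
  rewrite /Lam /=; set b := det v x in hu *.
  apply/dvdz_mod0P; have m0' : m%:Z != 0 by rewrite eqz_nat -lt0n.
  have := modz_ge0 b m0'; have := ltz_pmod b (_ : 0 < m%:Z).
  rewrite ltz_nat m0 => /(_ isT); case E : (b %% m)%Z => [k|//] hk _.
  case: k E hk => [//|k] E hk.
  have : L (u *~ k.+1%:Z).
    have -> : u *~ k.+1%:Z = u *~ b - u *~ m%:Z *~ (b %/ m)%Z.
      rewrite -E /modz mulrzBr; congr (_ - _); by rewrite -mulrzA mulrC.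
    by apply: lattice_sub => //; apply: lattice_mulz.
  move=> hk'; have := mmin k.+1; rewrite /= => /(_ (asboolT hk')).
  by rewrite leqNgt -ltz_nat hk.
move/dvdzP => [q hq]; rewrite (basis_expand x e) hq.
apply: lattice_add => //; first exact: lattice_mulz.
by rewrite mulrC mulrzA; apply: lattice_mulz.
Qed.

Lemma cocyclic_primitive L : cocyclic L -> exists2 v, primitive v & L v.
Proof.
move=> [lL [g hg]].
have [a ha] := hg (1, 0); have [b hb] := hg (0, 1).
(* [b (1, 0) - a (0, 1)] lies in [L], both terms being congruent to [a b g]. Its primitive direction
   [v] is the witness, though this only puts [d v] into [L]. *)
have [v [d [pv e]]] := primitive_multiple (b, - a); exists v => //.
have hdv : L (v *~ d).
  rewrite -e (_ : (b, - a) = ((1, 0) - g *~ a) *~ b - ((0, 1) - g *~ b) *~ a :> Z2).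
    by apply: lattice_sub => //; apply: lattice_mulz.
  rewrite !pairMz; case: g {hg ha hb} => x y /=; congr (_, _) => /=; ring.
have [j hj] := hg v.
(* [g] is congruent to [t g], so [1 - t] annihilates Z^2/L, while [d] divides [t]. Hence [v] is a
   combination of [(1 - t) v] and [d v]. *)
pose t := g.1 * a + g.2 * b.
have ht : L (g *~ (1 - t)).
  have -> : g *~ (1 - t) = ((1, 0) - g *~ a) *~ g.1 + ((0, 1) - g *~ b) *~ g.2.
    rewrite !pairMz /t; case: g {hg ha hb hj t} => x y /=; congr (_, _) => /=; ring.
  by apply: lattice_add => //; apply: lattice_mulz.
have hv : L (v *~ (1 - t)).
  have -> : v *~ (1 - t) = (v - g *~ j) *~ (1 - t) + g *~ (1 - t) *~ j.
    by rewrite mulrzBl -!mulrzA [(1 - t) * j]mulrC subrK.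
  by apply: lattice_add => //; apply: lattice_mulz.
move: e; rewrite pairMz => -[eb ea].
have -> : v = v *~ (1 - t) + v *~ d *~ (g.2 * v.1 - g.1 * v.2).
  rewrite -mulrzA -mulrzDr -[LHS]mulr1z; congr (_ *~ _).
  have ha' : a = - (v.2 * d) by rewrite -ea opprK.
  rewrite /t ha' eb; ring.
by apply: lattice_add => //; apply: lattice_mulz.
Qed.

Lemma cocyclicP L :
  cocyclic L <-> exists n v, [/\ (0 < n)%N, primitive v & L = Lam n v].
Proof.
split=> [cL|[n [v [n0 pv ->]]]]; last exact: cocyclic_Lam.
have [v pv hv] := cocyclic_primitive cL; case: cL => lL _.
by have [n n0 e] := lattice_primitive lL pv hv; exists n, v.
Qed.

(** Such a subgroup contains k Z^2, so the [k * k] pairs of residues represent all its cosets. *)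
Lemma lattice_of_multiples (L : set Z2) (k : nat) : (0 < k)%N -> L 0 ->
  (forall x y, L x -> L y -> L (x - y)) -> (forall x, L (x *~ k%:Z)) -> lattice L.
Proof.
move=> k0 L0 LB hk; apply/latticeP; split=> //.
pose f (ij : nat * nat) := coset L (ij.1%:Z, ij.2%:Z).
pose s := [seq (i, j) | i <- iota 0 k, j <- iota 0 k].
apply: (@sub_finite_set _ _ [set` [seq f x | x <- s]]); last exact: finite_seq.
move=> _ [v _ <-] /=; have k0' : k%:Z != 0 by rewrite eqz_nat -lt0n.
have red (a : int) : exists2 i : nat, (i < k)%N & exists q, a = q * k%:Z + i%:Z.
  have := modz_ge0 a k0'; have := ltz_pmod a (_ : 0 < k%:Z).
  rewrite ltz_nat k0 => /(_ isT); case E : (a %% k)%Z => [i|//] hi _.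
  by exists i => //; exists (a %/ k)%Z; rewrite -E -divz_eq.
have [i hi [q hq]] := red v.1; have [j hj [r hr]] := red v.2.
apply/mapP; exists (i, j); first by apply/allpairsP; exists (i, j); rewrite !mem_iota.
apply/coset_eq => //; have -> : v - (i%:Z, j%:Z) = (q, r) *~ k%:Z; last exact: hk.
rewrite pairMz; case: v hq hr => a b /= -> ->; congr (_, _) => /=; ring.
Qed.

Lemma lattice_multiples L : lattice L -> exists2 k, (0 < k)%N & forall x, L (x *~ k%:Z).
Proof.
move=> lL; have [m m0 hm] := lattice_torsion (1, 0) lL.
have [n n0 hn] := lattice_torsion (0, 1) lL.
exists (m * n)%N; first by rewrite muln_gt0 m0.
move=> x; have -> : x *~ (m * n)%N%:Z =
    (1, 0) *~ m%:Z *~ (n%:Z * x.1) + (0, 1) *~ n%:Z *~ (m%:Z * x.2).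
  rewrite !pairMz; case: x => a b; rewrite PoszM; congr (_, _) => /=; ring.
by apply: lattice_add => //; apply: lattice_mulz.
Qed.

Lemma latticeI L M : lattice L -> lattice M -> lattice (L `&` M).
Proof.
move=> lL lM; have [k k0 hk] := lattice_multiples lL.
have [l l0 hl] := lattice_multiples lM.
apply: (@lattice_of_multiples _ (k * l)); first by rewrite muln_gt0 k0.
- by split; [case/latticeP: lL | case/latticeP: lM].
- by move=> x y [? ?] [? ?]; split; apply: lattice_sub.
- move=> x; rewrite PoszM; split; last by rewrite mulrzA.
  by rewrite mulrC mulrzA.
Qed.

(** * Coverings, minimality and strong minimality *)

Lemma covering_primitive C : finite_set C -> C `<=` lattice ->
  (forall v, primitive v -> exists2 L, C L & L v) -> covering C.
Proof.
move=> fC lC h; split=> //; apply/seteqP; split=> // x _.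
have [v [k [pv ->]]] := primitive_multiple x.
have [L CL hv] := h v pv; exists L => //.
by apply: lattice_mulz => //; apply: lC.
Qed.

Lemma coveringE C v : covering C -> exists2 L, C L & L v.
Proof.
case=> _ _ e; have : setT v by [].
by rewrite -e => -[L CL hv]; exists L.
Qed.

Lemma covering_replace C L L' : covering C -> lattice L' ->
  (forall w, primitive w -> L w -> (forall M, C M -> M <> L -> ~ M w) -> L' w) ->
  covering (L' |` (C `\ L)).
Proof.
move=> cC lL' h; have [fC lC _] := cC; apply: covering_primitive.
- by rewrite finite_setU; split; [exact: finite_set1 | exact: finite_setD].
- by move=> M [->//|[/lC]].
move=> v pv; case: (pselect (exists2 M, (C `\ L) M & M v)).
  by case=> M hM Mv; exists M => //; right.
move=> hN; exists L'; first by left.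
have hM M : C M -> M <> L -> ~ M v.
  by move=> CM ML Mv; apply: hN; exists M.
apply: h => //; have [M CM Mv] := coveringE v cC.
by case: (pselect (M = L)) => [<-//|ML]; case: (hM M).
Qed.

(** A member without primitive vectors could be shrunk, since the others already cover every
    primitive vector. So each member contains one, and [lattice_primitive] applies. *)
Lemma minimal_cocyclic C L : minimal C -> C L -> cocyclic L.
Proof.
move=> [cC mC] CL; have [fC lC _] := cC; have lL := lC _ CL.
case: (pselect (exists2 v, primitive v & L v)) => [[v pv hv]|hN].
  have [n n0 ->] := lattice_primitive lL pv hv; exact: cocyclic_Lam.
have [n n0 hn] := lattice_torsion (1, 0) lL.
have p01 : primitive (0, 1) by [].
(* The second factor is chosen to leave out [n (1, 0)], which belongs to [L], so that the
   intersection is a proper sublattice. *)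
pose M := L `&` Lam (n * 2) (0, 1).
have lM : lattice M by apply: latticeI => //; apply: lattice_Lam; rewrite ?muln_gt0 ?n0.
case: (mC L M CL lM).
  split; first by move=> x [].
  move=> /(_ _ hn)[_]; rewrite /Lam /= pairMz /det /= !mul0r mul1r sub0r.
  rewrite rpredN mul1r => /dvdn_leq; rewrite n0 => /(_ isT).
  by rewrite /= leqNgt ltn_Pmulr.
by apply: covering_replace => // w pw Lw _; case: hN; exists w.
Qed.

(** Without such a [w] the sublattice could take the place of [Lam d v], by [covering_replace].
    Later arguments use minimality through these private vectors. *)
Lemma minimal_private C d v m z : minimal C -> C (Lam d v) -> primitive v ->
  primitive z -> (0 < m)%N -> Lam m z `<` Lam d v ->
  exists w, [/\ primitive w, Lam d v w, ~ Lam m z w &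
     forall M, C M -> M <> Lam d v -> ~ M w].
Proof.
move=> [cC mC] CL pv pz m0 hlt; apply: contrapT => hN.
apply: (mC _ (Lam m z) CL _ hlt); first exact: lattice_Lam.
apply: covering_replace => //; first exact: lattice_Lam.
by move=> w pw Lw hw; apply: contrapT => nw; apply: hN; exists w.
Qed.

(** A sublattice replacing [L = Lam n v] must contain all primitive vectors of [L], since no other
    member contains any of them; but the primitive vectors [v] and [v + n u] already generate
    [L]. *)
Lemma exact_strongly_minimal C : finite_set C -> C `<=` cocyclic ->
  (forall v, primitive v -> exists! L, C L /\ L v) -> strongly_minimal C.
Proof.
move=> fC cC h; split=> //; split.
  apply: covering_primitive => // [L /cC[]//|v pv].
  by have [L [[CL Lv] _]] := h v pv; exists L.
move=> L L' CL lL' [sub nsub] cov.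
have hL' w : primitive w -> L w -> L' w.
  move=> pw Lw; have [L0 [_ u]] := h w pw.
  have [M [->//|[CM nML]] Mw] := coveringE w cov.
  by case: nML; rewrite /= -(u M) // -(u L).
have [n [v [n0 pv e]]] := (cocyclicP L).1 (cC _ CL).
have [u eu] := primitive_basis pv.
have L'v : L' v by apply: hL' => //; rewrite e; apply: Lam_refl.
have L'nu : L' (u *~ n).
  have -> : u *~ n = (v + u *~ n) - v by rewrite addrC addKr.
  apply: lattice_sub => //; apply: hL'.
    by apply: (@basis_primitive _ u); move: eu; rewrite /det pairMz => <- /=; ring.
  by rewrite e /Lam /= detDr det_refl add0r detMr eu mul1r dvdzz.
apply: nsub => x; rewrite e /Lam /= => /dvdzP[q hq].
rewrite (basis_expand x eu) hq; apply: lattice_add => //.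
  exact: lattice_mulz.
by rewrite mulrC mulrzA; apply: lattice_mulz.
Qed.

(** * Simpson's bound *)

(** The vector [n v + m w] is congruent to [n v] modulo [m] and to [m w] modulo [n], with unit
    factors; its primitive direction lies in both classes. *)
Lemma Lam_crt m n v w : (0 < m)%N -> (0 < n)%N -> coprime m n -> primitive v ->
  primitive w -> exists z, [/\ primitive z, Lam m v z & Lam n w z].
Proof.
move=> m0 n0 cmn pv pw.
have [z [k [pz e]]] := primitive_multiple (v *~ n%:Z + w *~ m%:Z).
have key (a b : nat) (x y : Z2) : primitive x -> coprime a b ->
    (z *~ k = x *~ b%:Z + y *~ a%:Z) -> Lam a x z.
  move=> px cab h.
  have hd : (a%:Z %| det x z * k)%Z.
    by rewrite -detMr h detDr !detMr det_refl mul0r add0r dvdz_mull.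
  (* The factor [k] split off from the sum is prime to [a]: a common divisor of the two divides [b]
     as well, and [a], [b] are coprime. *)
  suff cak : coprimez a k by rewrite /Lam /= -(Gauss_dvdzl _ cak).
  have [u eu] := primitive_basis px.
  rewrite /coprimez; set g := gcdz a k.
  have gb : (g %| b%:Z)%Z.
    have -> : b%:Z = det z u * k - det y u * a%:Z.
      have := congr1 (fun r => det r u) h.
      rewrite [det (_ + _) u]det_opp detDr !detMr [det u x]det_opp eu [det u y]det_opp.
      by rewrite det_opp detMr [det u z]det_opp => h'; rewrite -[b%:Z]mul1r; lia.
    by rewrite rpredB // dvdz_mull // ?dvdz_gcdr ?dvdz_gcdl.
  have : (g %| gcdz a%:Z b%:Z)%Z by rewrite dvdz_gcd gb dvdz_gcdl.
  by rewrite /gcdz /= (eqP cab) dvdz1.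
exists z; split=> //.
  by apply: (key m n v w) => //; rewrite -e.
by apply: (key n m w v) => //; [rewrite coprime_sym | rewrite -e addrC].
Qed.

Lemma Lam_crt_primes (K : nat) (W : nat -> Z2) (ps : seq nat) :
  uniq ps -> all prime ps -> (forall p, primitive (W p)) ->
  exists2 z, primitive z & forall p, p \in ps -> Lam (p ^ K) (W p) z.
Proof.
move=> + + hW; elim: ps => [|p ps IH]; first by exists (W 0%N).
move=> /= /andP[pnps us] /andP[pp aps]; have [z pz hz] := IH us aps.
have gt0 : (0 < \prod_(q <- ps) q ^ K)%N.
  by rewrite big_seq; apply: prodn_cond_gt0 => q qs; rewrite expn_gt0 prime_gt0 ?(allP aps).
have cop : coprime (p ^ K) (\prod_(q <- ps) q ^ K)%N.
  rewrite big_seq; apply: (big_ind (fun x => coprime (p ^ K) x)).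
  - exact: coprimen1.
  - by move=> x y hx hy; rewrite coprimeMr hx.
  - move=> q qs; apply/coprimeXl/coprimeXr; rewrite prime_coprime // dvdn_prime2 //.
      by apply: contraNneq pnps => ->.
    exact: (allP aps).
have [|z' [pz' h1 h2]] := Lam_crt _ gt0 cop (hW p) pz.
  by rewrite expn_gt0 prime_gt0.
exists z' => // q; rewrite inE => /orP[/eqP->//|qs].
apply: (Lam_trans pz (hz q qs)); apply: Lam_dvd h2.
by rewrite (big_rem q) //= dvdn_mulr.
Qed.

(** A point of P^1(Z/p^J) has [p] lifts modulo p^(J+1), and [p + 1] when [J = 0]; each forbidden
    vector rules out at most one of them. *)
Lemma Lam_child p J w (forb : seq Z2) : prime p -> primitive w ->
  (forall x, x \in forb -> primitive x) ->
  (size forb < p + (J == 0))%N ->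
  exists w', [/\ primitive w', Lam (p ^ J) w w' &
    forall x, x \in forb -> ~ Lam (p ^ J.+1) x w'].
Proof.
move=> pp pw pforb lt; have [u e] := primitive_basis pw.
have pJ0 : (p ^ J)%N%:Z != 0 by rewrite eqz_nat -lt0n expn_gt0 prime_gt0.
pose c (t : nat) := w + u *~ (t%:Z * (p ^ J)%N%:Z).
(* The second list adds [u], the point at infinity, exactly when [J = 0]. *)
pose cand := [seq c t | t <- iota 0 p] ++ [seq u | i <- iota 0 (J == 0)].
have det_c s t : det (c s) (c t) = (t%:Z - s%:Z) * (p ^ J)%N%:Z.
  rewrite -[RHS]mulr1 -e /c !pairMz; case: w u {c cand e pw} => a b [x y].
  rewrite /det /=; ring.
have det_cu s : det (c s) u = 1.
  rewrite -e /c !pairMz; case: w u {c cand e det_c pw} => a b [x y].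
  rewrite /det /=; ring.
have pc s : primitive (c s) by apply: basis_primitive (det_cu s).
have pcand x : x \in cand -> primitive x /\ Lam (p ^ J) w x.
  rewrite mem_cat => /orP[/mapP[t _ ->]|].
    split=> //; rewrite (_ : w = c 0%N) ?/Lam /= ?det_c ?dvdz_mull //.
    by rewrite /c mul0r mulr0z addr0.
  case: (J =P 0%N) => // -> /=; rewrite inE => /eqP ->; split.
    by apply: (@basis_primitive _ (- w)); rewrite detNr det_opp opprK.
  by rewrite expn0 Lam1.
have sep s t : (s < p)%N -> (t < p)%N -> Lam (p ^ J.+1) (c s) (c t) -> s = t.
  move=> sp tp; rewrite /Lam /= det_c expnS PoszM dvdz_mul2r //.
  rewrite -eqz_mod_dvd !modz_small ?ltz_nat //; by move/eqP => [].
have sepu s : J = 0%N -> ~ Lam (p ^ J.+1) (c s) u.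
  move=> ->; rewrite /Lam /= det_cu expn1 dvdz1 /= => /eqP p1.
  by rewrite p1 in pp.
have memc x : x \in cand -> (exists2 t, (t < p)%N & x = c t) \/ (J = 0%N /\ x = u).
  rewrite mem_cat => /orP[/mapP[t]|].
    by rewrite mem_iota => tp ->; left; exists t.
  by case: (J =P 0%N) => //= J0; rewrite inE => /eqP ->; right.
have sepc x y : x \in cand -> y \in cand -> Lam (p ^ J.+1) x y -> x = y.
  move=> /memc[[s sp ->]|[J0 ->]] /memc[[t tp ->]|[J0' ->]] //.
  - by move/sep => ->.
  - by move/(sepu _ J0').
  - by move/Lam_sym/(sepu _ J0).
have ucand : uniq cand.
  rewrite cat_uniq map_inj_in_uniq ?iota_uniq /=; last first.
    move=> s t; rewrite !mem_iota /= => sp tp est; apply: sep => //.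
    by rewrite est; apply: Lam_refl.
  case: (J =P 0%N) => //= J0; rewrite orbF andbT.
  by apply/mapP => -[s _ us]; apply: (sepu s J0); rewrite -us; apply: Lam_refl.
apply: contrapT => hN.
(* Pigeonhole: were all candidates forbidden, each would be sent to the first forbidden vector in
   its class, and distinct candidates have distinct classes. *)
pose g x := find (fun y => ((p ^ J.+1)%N%:Z %| det y x)%Z) forb.
have hg x : x \in cand -> has (fun y => ((p ^ J.+1)%N%:Z %| det y x)%Z) forb.
  move=> xc; apply: contrapT => nh; apply: hN; exists x; have [px wx] := pcand x xc.
  by split=> // y yf hy; apply: nh; apply/hasP; exists y.
have : (size cand <= size forb)%N.
  have := @uniq_leq_size _ (map g cand) (iota 0 (size forb)).
  rewrite size_map size_iota; apply.
    rewrite map_inj_in_uniq // => x y xc yc gxy; apply: sepc => //.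
    have := nth_find 0 (hg x xc); have := nth_find 0 (hg y yc).
    rewrite -/(g x) -/(g y) -gxy; set z := nth _ _ _ => hy hx.
    have pz : primitive z by apply/pforb/mem_nth; rewrite -has_find hg.
    by apply: (@Lam_trans _ _ z) => //; apply: Lam_sym.
  by move=> _ /mapP[x xc ->]; rewrite mem_iota -has_find hg.
by rewrite size_cat !size_map !size_iota leqNgt lt.
Qed.

Lemma dvdz_prime_parts (d : nat) (x : int) : (0 < d)%N ->
  (forall p, prime p -> ((p ^ logn p d)%N%:Z %| x)%Z) -> (d%:Z %| x)%Z.
Proof.
move=> d0 h; rewrite /dvdz /=; apply/dvdn_partP => // p /[!mem_primes] /and3P[pp _ _].
by rewrite p_part; apply: h.
Qed.

(* The [p]-adic digits of a point of P^1(Z/N): the first digit takes [p + 1]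
   values and the following ones [p], and slot [(p, j, t)] is the [t]-th of the
   values of the [j]-th digit, one value being left out. *)
Definition slot (B : nat) : finType := ('I_B * 'I_B * 'I_B)%type.
Definition slots (B d : nat) : {set slot B} :=
  [set s : slot B | [&& prime s.1.1, 0 < s.1.2, s.2 < s.1.1.-1 + (s.1.2 == 1%N :> nat)
                & s.1.1 ^ s.1.2 %| d]%N]%SET.

(** Up to digit [k0], the last one that matters to [G] at [p], the vector copies [w0]; no slot in
    use lies there, as its prime power would divide an index in [G]. Each later digit is chosen to
    avoid the boxes matched to its slots, which are fewer than its values. *)
Lemma slots_ladder n B (d : 'I_n -> nat) (v : 'I_n -> Z2) (G : {set 'I_n}) w0
    (f : 'I_n -> slot B) (p : nat) :
  prime p -> primitive w0 -> (forall i, (0 < d i < B)%N) -> (forall i, primitive (v i)) ->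
  {in ~: G &, injective f}%SET ->
  (forall i, i \notin G -> f i \in slots B (d i) /\
     forall k, k \in G -> ~~ ((f i).1.1 ^ (f i).1.2 %| d k)%N) ->
  exists w, [/\ primitive w,
    forall k, k \in G -> Lam (p ^ logn p (d k)) w0 w &
    forall i, i \notin G -> (f i).1.1 = p :> nat -> ~ Lam (p ^ (f i).1.2) (v i) w].
Proof.
move=> pp pw0 dB pv fi fG.
pose k0 := \max_(k in G) logn p (d k).
suff h m : exists w, [/\ primitive w, Lam (p ^ k0) w0 w &
    forall i, i \notin G -> (f i).1.1 = p :> nat -> ((f i).1.2 <= k0 + m)%N ->
      ~ Lam (p ^ (f i).1.2) (v i) w].
  (* Digit positions of slots lie in ['I_B], so [B] further digits reach all of them. *)
  have [w [pw h0 hi]] := h B; exists w; split=> //.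
    move=> k kG; apply: Lam_dvd h0; apply: dvdn_exp2l.
    exact: (leq_bigmax_cond (F := fun k => logn p (d k))).
  by move=> i iG e; apply: hi => //; apply: leq_trans (leq_addl _ _); apply: ltnW.
elim: m => [|m [w [pw h0 hi]]].
  exists w0; split=> //; first exact: Lam_refl.
  move=> i iG e; rewrite addn0 => le _.
  have [] := fG i iG; rewrite inE => /and4P[_ j0 _ _] hG.
  have [kz|knz] := posnP k0; first by rewrite kz leqn0 -[_ == _]negbK -lt0n j0 in le.
  case: (set_0Vmem G) => [G0|[k1 k1G]]; first by rewrite /k0 G0 big_set0 in knz.
  have [k kG ek] : {k | k \in G & k0 = logn p (d k)}.
    by apply: (@eq_bigmax_cond _ (mem G) (fun k => logn p (d k))); rewrite card_gt0; apply/set0Pn; exists k1.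
  case/negP: (hG k kG); rewrite e pfactor_dvdn -?ek //.
  by case/andP: (dB k).
pose A := [set i | (i \notin G) && ((f i).1.1 == p :> nat) && ((f i).1.2 == (k0 + m).+1 :> nat)]%SET.
pose forb := [seq v i | i <- enum A].
(* The boxes matched at this digit have distinct slots, and the digit has one slot fewer than it has
   values. *)
have szforb : (size forb < p + ((k0 + m)%N == 0%N))%N.
  rewrite size_map -cardE.
  rewrite -[X in (_ < X + _)%N](prednK (prime_gt0 pp)) addSn ltnS.
  have := @uniq_leq_size _ [seq val (f i).2 | i <- enum A]
    (iota 0 (p.-1 + ((k0 + m)%N == 0%N))).
  rewrite size_map -cardE size_iota; apply.
    rewrite map_inj_in_uniq ?enum_uniq // => i j.
    rewrite !mem_enum !inE => /andP[/andP[iG /eqP ip] /eqP ij] /andP[/andP[jG /eqP jp] /eqP jj] e.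
    apply: fi; rewrite ?inE //; case: (f i) (f j) ip ij jp jj e => [[a b] c] [[a' b'] c'] /=.
    move=> ea eb ea' eb' ec; congr (_, _, _); apply: val_inj => /=; congruence.
  move=> t /mapP[i]; rewrite mem_enum inE => /andP[/andP[iG /eqP ip] /eqP ij] ->.
  have [+ _] := fG i iG; rewrite mem_iota inE ip ij eqSS => /and4P[_ _ + _].
  by [].
have [|w' [pw' ww' hw']] := Lam_child pp pw _ szforb.
  by move=> x /mapP[i _ ->].
exists w'; split=> //.
  by apply: (Lam_trans pw h0); apply: Lam_dvd ww'; rewrite dvdn_exp2l // leq_addr.
move=> i iG ip; rewrite addnS leq_eqVlt => /orP[/eqP ij|].
  rewrite ij; apply: hw'; apply/mapP; exists i => //.
  by rewrite mem_enum inE iG ip ij !eqxx.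
rewrite ltnS => ij hv; apply: (hi i iG ip ij); apply: (Lam_trans pw' hv).
by apply: Lam_sym; apply: Lam_dvd ww'; apply: dvdn_exp2l.
Qed.

(** The choices at different primes are independent by the Chinese remainder theorem. Only primes
    below [B] divide the indices, and the exponent [B] exceeds every valuation. *)
Lemma slots_extend n B (d : 'I_n -> nat) (v : 'I_n -> Z2) (G : {set 'I_n}) w0
    (f : 'I_n -> slot B) :
  primitive w0 -> (forall i, (0 < d i < B)%N) -> (forall i, primitive (v i)) ->
  {in ~: G &, injective f}%SET ->
  (forall i, i \notin G -> f i \in slots B (d i) /\
     forall k, k \in G -> ~~ ((f i).1.1 ^ (f i).1.2 %| d k)%N) ->
  exists w, [/\ primitive w, forall k, k \in G -> Lam (d k) w0 w &
    forall i, i \notin G -> ~ Lam (d i) (v i) w].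
Proof.
move=> pw0 dB pv fi fG.
have H (p : nat) : exists w, primitive w /\ (prime p ->
    (forall k, k \in G -> Lam (p ^ logn p (d k)) w0 w) /\
    forall i, i \notin G -> (f i).1.1 = p :> nat -> ~ Lam (p ^ (f i).1.2) (v i) w).
  case: (boolP (prime p)) => pp; last by exists w0; split.
  by have [w [pw h1 h2]] := slots_ladder pp pw0 dB pv fi fG; exists w.
have [W hW] := choice H.
have pW p : primitive (W p) by case: (hW p).
have [z pz hz] : exists2 z, primitive z & forall p, prime p -> (p < B)%N -> Lam (p ^ B) (W p) z.
  pose ps := [seq p <- iota 0 B | prime p].
  have [||z pz hz] := @Lam_crt_primes B W ps _ _ pW.
  - by rewrite filter_uniq ?iota_uniq.
  - exact: filter_all.
  by exists z => // p pp pB; apply: hz; rewrite mem_filter pp mem_iota.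
have dlt i : (d i < B)%N by case/andP: (dB i).
have d0 i : (0 < d i)%N by case/andP: (dB i).
exists z; split=> //.
  move=> k kG; apply: dvdz_prime_parts => // p pp.
  case: (ltnP p B) => [pB|Bp]; last first.
    rewrite (_ : logn p (d k) = 0%N) ?expn0 ?dvd1z //.
    apply/eqP; rewrite -leqn0 leqNgt -pfactor_dvdn // expn1.
    by apply/negP => /dvdn_leq; rewrite d0 leqNgt (leq_trans (dlt k) Bp) => /(_ isT).
  have [_ /(_ pp)[h _]] := hW p.
  apply: (Lam_trans (pW p) (h k kG)); apply: Lam_dvd (hz p pp pB).
  apply: dvdn_exp2l; apply: leq_trans (ltnW (dlt k)).
  by apply: ltnW; apply: ltn_logl.
move=> i iG hi.
have [] := fG i iG; rewrite inE => /and4P[pp j0 _ pd] _.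
have [_ /(_ pp)[_ h]] := hW (f i).1.1; apply: (h i iG erefl).
apply: (@Lam_trans _ _ z) => //; first exact: Lam_dvd hi.
apply: Lam_sym; apply: Lam_dvd (hz _ pp (ltn_ord _)).
by apply: dvdn_exp2l; apply: ltnW.
Qed.

(* Simpson's lower bound for the size of an irredundant covering, by Tarsi's
   argument.  If the bound fails, choose a proper subfamily [G] maximizing
   [#|G| - #|slots of G|].  By maximality Hall's condition holds between the
   remaining boxes and the slots that [G] does not use.  A point avoiding [G] then
   extends to an uncovered point: each remaining box is avoided at the digit of
   the slot matched to it. *)
Lemma slots_bound n B (d : 'I_n -> nat) (v : 'I_n -> Z2) :
  (forall i, (0 < d i < B)%N) -> (forall i, primitive (v i)) ->
  (forall w, primitive w -> exists i, Lam (d i) (v i) w) ->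
  (forall G : {set 'I_n}, G != [set: 'I_n]%SET ->
     exists2 w, primitive w & forall i, i \in G -> ~ Lam (d i) (v i) w) ->
  (#|(\bigcup_i slots B (d i))%SET| < n)%N.
Proof.
move=> dB pv cov irr; rewrite ltnNge; apply/negP => le.
have n0 : (0 < n)%N.
  have [i _] := cov (1, 0) isT; exact: leq_ltn_trans (ltn_ord i).
have T0 : (finset.set0 : {set 'I_n}) != [set: 'I_n]%SET.
  apply/eqP => e; have := cardsT 'I_n; rewrite -e cards0 card_ord => nz.
  by rewrite -nz in n0.
pose S (H : {set 'I_n}) := (\bigcup_(i in H) slots B (d i))%SET.
pose M := #|slot B|.
have SM H : (#|S H| <= M)%N by apply: max_card.
have S0 : #|S finset.set0| = 0%N by rewrite /S big_set0 cards0.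
(* The shift by the number [M] of all slots keeps the difference a natural number. *)
pose wt (H : {set 'I_n}) := (#|H| + (M - #|S H|))%N.
case: (@arg_maxnP _ finset.set0 (fun H : {set 'I_n} => H != [set: 'I_n]%SET) wt T0) => G GT Gmax.
have SU H : S (G :|: H)%SET = (S G :|: S H)%SET by apply: finset.bigcup_setU.
have s0 : slot B.
  have B0 : (0 < B)%N by case/andP: (dB (Ordinal n0)) => _; apply: leq_ltn_trans.
  exact: ((Ordinal B0, Ordinal B0), Ordinal B0).
have [|f [fi fE]] := @hall _ _ s0 (fun i => slots B (d i) :\: S G)%SET (~: G)%SET.
  move=> H HG.
  have -> : (\bigcup_(x in H) (slots B (d x) :\: S G))%SET = (S (G :|: H) :\: S G)%SET.
    rewrite SU finset.setDUl finset.setDv finset.set0U /S.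
    apply/setP => s; rewrite !inE; apply/bigcupP/andP.
      by case=> x xH; rewrite inE => /andP[? ?]; split=> //; apply/bigcupP; exists x.
    by case=> ? /bigcupP[x xH ?]; exists x; rewrite // inE; apply/andP.
  have sub : (S G \subset S (G :|: H)%SET)%SET by rewrite SU finset.subsetUl.
  rewrite cardsD (finset.setIidPr sub) leq_subRL ?subset_leq_card //.
  have dis : (#|G :|: H| = #|G| + #|H|)%N.
    by rewrite cardsU disjoint_setI0 ?cards0 ?subn0 // disjoint_sym finset.disjoints_subset.
  (* If [G :|: H] is the whole family, maximality does not speak of it. Comparing [G] with the empty
     family instead gives [#|S G| <= #|G|], and [le] provides the slots for [H]. *)
  have [GH|GH] := eqVneq (G :|: H)%SET [set: 'I_n]%SET.
    have ar (a b c e m l : nat) : (l <= b)%N -> (c + e)%N = l -> (a <= m)%N ->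
      (0 + m <= c + (m - a))%N -> (a + e <= b)%N by lia.
    have eST : S [set: 'I_n]%SET = (\bigcup_i slots B (d i))%SET.
      by apply: eq_bigl => i; rewrite inE.
    have e1 : (#|G| + #|H|)%N = n by rewrite -dis GH cardsT card_ord.
    have e2 : (0 + M <= #|G| + (M - #|S G|))%N.
      by have := Gmax finset.set0 T0; rewrite /= /wt S0 cards0 subn0.
    rewrite GH eST; exact: ar le e1 (SM G) e2.
  have ar (a b c e m : nat) : (a <= m)%N -> (b <= m)%N ->
    (c + e + (m - b) <= c + (m - a))%N -> (a + e <= b)%N by lia.
  apply: ar (SM G) (SM _) _; have := Gmax _ GH; rewrite /= /wt dis; exact.
have [w0 pw0 hw0] := irr G GT.
have [|w [pw h1 h2]] := @slots_extend n B d v G w0 f pw0 dB pv fi.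
  move=> i iG; have := fE i; rewrite finset.in_setC iG finset.in_setD => /(_ isT) /andP[nS us].
  split=> //.
  move=> k kG; apply: contra nS => dk; apply/bigcupP; exists k => //.
  by move: us; rewrite !inE => /and4P[-> -> -> _].
have [i hi] := cov w pw; case: (boolP (i \in G)) => iG; last exact: h2 hi.
by apply: (hw0 i iG); apply: (Lam_trans pw hi); apply: Lam_sym; apply: h1.
Qed.

(** * The moduli that the bound allows *)

Definition slot_count (p k : nat) : nat := (k * p.-1 + (0 < k))%N.

Lemma slots_card n B (d : 'I_n -> nat) p q i j : (forall i, (0 < d i < B)%N) ->
  prime p -> prime q -> p != q ->
  (slot_count p (logn p (d i)) + slot_count q (logn q (d j)) <= #|(\bigcup_i slots B (d i))%SET|)%N.
Proof.
move=> dB pp pq npq.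
(* The first list is the extra slot of the first digit, present when [k] is positive; the second has
   [p.-1] slots for each of the [k] digits. *)
pose sl p k := [seq (p, 1%N, p.-1) | _ <- iota 0 (0 < k)] ++
               [seq (p, a, t) | a <- iota 1 k, t <- iota 0 p.-1].
have size_sl r k : size (sl r k) = slot_count r k.
  by rewrite size_cat size_allpairs !size_map !size_iota addnC.
have mem_sl r k x : x \in sl r k ->
    [/\ x.1.1 = r, (0 < x.1.2 <= k)%N & (x.2 < r.-1 + (x.1.2 == 1%N))%N].
  rewrite mem_cat => /orP[/mapP[y]|/allpairsP[[a t] /= []]].
    by case: k => // k; rewrite mem_iota => _ ->; split=> //=; lia.
  by rewrite !mem_iota => ha ht ->; split=> //=; case: eqP => /=; lia.
have uniq_sl r k : uniq (sl r k).
  rewrite cat_uniq; apply/and3P; split; first by case: k.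
    apply/hasPn => x /allpairsP[[a t] /= []]; rewrite !mem_iota => _ /andP[_ ht] ->.
    by apply/mapP => -[y _ [_ e]]; rewrite e add0n ltnn in ht.
  apply: allpairs_uniq; rewrite ?iota_uniq // => -[a t] [a' t'] _ _ /= [-> ->] //.
rewrite -!size_sl -size_cat.
pose g (s : slot B) := (val s.1.1, val s.1.2, val s.2).
rewrite cardE -(size_map g); apply: uniq_leq_size.
  rewrite cat_uniq !uniq_sl andbT /=; apply/hasPn => x /mem_sl[xq _ _].
  by apply/negP => /mem_sl[xp _ _]; rewrite -xp -xq eqxx in npq.
suff key r i0 x : prime r -> x \in sl r (logn r (d i0)) -> x \in [seq g s | s <- enum (\bigcup_i slots B (d i))%SET].
  by move=> x; rewrite mem_cat => /orP[]; apply: key.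
move=> pr /mem_sl; case: x => [[r' a] t] /= [-> ha ht].
have [d0 dlt] := andP (dB i0).
have rad : (r ^ a %| d i0)%N by rewrite pfactor_dvdn //; case/andP: ha.
have aB : (a < B)%N.
  by case/andP: ha => _ ha; have := ltn_logl r d0; lia.
have rB : (r < B)%N.
  apply: leq_ltn_trans dlt; apply: dvdn_leq => //; apply: dvdn_trans rad.
  by rewrite dvdn_exp //; case/andP: ha.
have tB : (t < B)%N by have := prime_gt0 pr; case: eqP ht => _ /=; lia.
apply/mapP; exists ((Ordinal rB, Ordinal aB), Ordinal tB) => //.
rewrite mem_enum; apply/bigcupP; exists i0 => //.
by rewrite inE /= pr ht rad; case/andP: ha => ->.
Qed.

(** Distinct primes [p], [q] dividing indices satisfy [p + q <= 7], which leaves only the pairs 2, 3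
    and 2, 5; so inequalities for two primes at a time settle everything. The cases run from the
    prime 7 downwards, since 7 excludes every other prime and 5 admits only 2. *)
Lemma slots_moduli n B (d : 'I_n -> nat) : (n <= 8)%N -> (forall i, (0 < d i < B)%N) ->
  (#|(\bigcup_i slots B (d i))%SET| < n)%N ->
  exists2 N, N \in [:: 7; 10; 27; 18; 24; 64]%N & forall i, (d i %| N)%N.
Proof.
move=> n8 dB lt.
have pair p q i j : prime p -> prime q -> p != q ->
    (logn p (d i) * p.-1 + (0 < logn p (d i)) +
     (logn q (d j) * q.-1 + (0 < logn q (d j))) <= 7)%N.
  by move=> pp pq npq; have := slots_card i j dB pp pq npq; rewrite /slot_count; lia.
have single p i : prime p -> (logn p (d i) * p.-1 + (0 < logn p (d i)) <= 7)%N.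
  move=> pp; case: (eqVneq p 2%N) => [e|p2].
    by have := pair p 3%N i i pp isT; rewrite e => /(_ isT); lia.
  by have := pair p 2%N i i pp isT p2; lia.
have suffi N : (0 < N)%N -> (forall p i, prime p -> (p <= 7)%N -> (logn p (d i) <= logn p N)%N) ->
    forall i, (d i %| N)%N.
  move=> N0 h i; have d0 : (0 < d i)%N by case/andP: (dB i).
  apply/dvdn_partP => // p; rewrite mem_primes p_part => /and3P[pp _ pd].
  rewrite pfactor_dvdn //; apply: h => //; rewrite leqNgt; apply/negP => p7.
  have : (0 < logn p (d i))%N by rewrite logn_gt0 mem_primes pp d0.
  by have := single p i pp; case: (logn p _) => // k; nia.
have le7 p : prime p -> (p <= 7)%N -> p \in [:: 2; 3; 5; 7]%N.
  by move=> + h; move: p h; do 8!case=> //.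
pose k p := \max_i logn p (d i).
have kE p : k p = 0%N \/ exists i, k p = logn p (d i).
  case: n d @k {lt dB pair single suffi} n8 => [|m] d k _; first by left; rewrite /k big_ord0.
  right; have [|i _ e] := @eq_bigmax_cond _ predT (fun i => logn p (d i)).
    by rewrite card_ord.
  by exists i.
have kle p i : (logn p (d i) <= k p)%N by apply: (leq_bigmax i).
have kpair p q : prime p -> prime q -> p != q ->
    (k p * p.-1 + (0 < k p) + (k q * q.-1 + (0 < k q)) <= 7)%N.
  move=> pp pq npq; case: (kE p) => [->|[i ->]]; case: (kE q) => [->|[j ->]] //.
  - by have := single q j pq; lia.
  - by have := single p i pp; lia.
  - exact: pair.
have h23 := kpair 2%N 3%N isT isT isT; have h25 := kpair 2%N 5%N isT isT isT.
have h27 := kpair 2%N 7%N isT isT isT; have h35 := kpair 3%N 5%N isT isT isT.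
have h37 := kpair 3%N 7%N isT isT isT; have h57 := kpair 5%N 7%N isT isT isT.
rewrite /= in h23 h25 h27 h35 h37 h57.
have fin N : (0 < N)%N -> (k 2 <= logn 2 N)%N -> (k 3 <= logn 3 N)%N ->
    (k 5 <= logn 5 N)%N -> (k 7 <= logn 7 N)%N -> forall i, (d i %| N)%N.
  move=> N0 h2 h3 h5 h7; apply: suffi => // p i pp p7.
  apply: leq_trans (kle p i) _.
  by have := le7 p pp p7; rewrite !inE => /or4P[]/eqP->.
case: (posnP (k 7%N)) => k7; last first.
  exists 7%N => //; apply: fin => //.
  - by rewrite (_ : logn 2%N 7%N = 0%N) //; lia.
  - by rewrite (_ : logn 3%N 7%N = 0%N) //; lia.
  - by rewrite (_ : logn 5%N 7%N = 0%N) //; lia.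
  - by rewrite (_ : logn 7%N 7%N = 1%N) //; lia.
case: (posnP (k 5%N)) => k5; last first.
  exists 10%N => //; apply: fin => //; rewrite ?k7 //.
  - by rewrite (_ : logn 2%N 10%N = 1%N) //; lia.
  - by rewrite (_ : logn 3%N 10%N = 0%N) //; lia.
  - by rewrite (_ : logn 5%N 10%N = 1%N) //; lia.
case: (posnP (k 3%N)) => k3.
  exists 64%N => //; apply: fin => //; rewrite ?k3 ?k5 ?k7 //.
  by rewrite (_ : logn 2%N 64%N = 6%N) //; lia.
case: (ltnP (k 3%N) 2%N) => k3'.
  exists 24%N => //; apply: fin => //; rewrite ?k5 ?k7 //.
  by rewrite (_ : logn 2%N 24%N = 3%N) //; lia.
case: (ltnP (k 3%N) 3%N) => k3''.
  exists 18%N => //; apply: fin => //; rewrite ?k5 ?k7 //.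
  by rewrite (_ : logn 2%N 18%N = 1%N) //; lia.
exists 27%N => //; apply: fin => //; rewrite ?k5 ?k7 //.
- by rewrite (_ : logn 2%N 27%N = 0%N) //; lia.
- by rewrite (_ : logn 3%N 27%N = 3%N) //; lia.
Qed.

Lemma finite_covering_seq (C : set (set Z2)) n : (C #= `I_n)%card ->
  exists Ls : seq (set Z2), [/\ uniq Ls, size Ls = n & [set` Ls] = C].
Proof.
move=> cn; have : finite_set C by apply/finite_setP; exists n.
move=> /finite_seqP[s e]; exists (undup s); rewrite undup_uniq.
have e' : [set` undup s] = C.
  by rewrite e; apply/seteqP; split=> x /=; rewrite mem_undup.
by split=> //; apply/eqP; rewrite -card_eq_seq ?undup_uniq // e'.
Qed.

Lemma minimal_moduli C n : (n <= 8)%N -> minimal C -> (C #= `I_n)%card ->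
  exists2 N, N \in [:: 7; 10; 27; 18; 24; 64]%N &
    forall L, C L -> exists d v, [/\ (0 < d)%N, (d %| N)%N, primitive v & L = Lam d v].
Proof.
move=> n8 mC cn; have [Ls [uLs sLs eLs]] := finite_covering_seq cn.
have CE L : C L <-> L \in Ls by rewrite -eLs.
pose X (i : 'I_n) := nth setT Ls i.
have CX i : C (X i) by apply/CE/mem_nth; rewrite sLs.
have hX i : exists b : nat * Z2, [/\ (0 < b.1)%N, primitive b.2 & X i = Lam b.1 b.2].
  by have [d [v h]] := (cocyclicP _).1 (minimal_cocyclic mC (CX i)); exists (d, v).
have [b hb] := choice hX.
pose d i := (b i).1; pose v i := (b i).2.
have XE i : X i = Lam (d i) (v i) by case: (hb i).
have d0 i : (0 < d i)%N by case: (hb i).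
have pv i : primitive (v i) by case: (hb i).
have surj L : C L -> exists i, X i = L.
  move=> /CE hL; have hi : (index L Ls < n)%N by rewrite -sLs index_mem.
  by exists (Ordinal hi); rewrite /X /= nth_index.
pose B := (\max_i d i).+1.
have dB i : (0 < d i < B)%N by rewrite d0 ltnS; apply: (leq_bigmax i).
have lt : (#|(\bigcup_i slots B (d i))%SET| < n)%N.
  apply: (@slots_bound n B d v dB pv).
    move=> w pw; have [L /surj[i <-]] := coveringE w mC.1.
    by rewrite XE; exists i.
  move=> G GT; have [i iG] : exists i, i \notin G.
    apply/existsP; rewrite -negb_forall; apply: contra GT => /forallP h.
    by apply/eqP/setP => i; rewrite h finset.inE.
  have iX : C (Lam (d i) (v i)) by rewrite -XE.
  have sub : Lam (d i * 2) (v i) `<` Lam (d i) (v i).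
    split; first by apply: Lam_dvd; rewrite dvdn_mulr.
    move/(Lam_subP (pv i) (pv i)) => [/dvdn_leq h _].
    by have := h (d0 i); have := d0 i; lia.
  have [|w [pw _ _ hw]] := minimal_private mC iX (pv i) (pv i) _ sub.
    by rewrite muln_gt0 d0.
  exists w => // j jG; apply: hw => [|e]; first by rewrite -XE.
  have e' : X i = X j by rewrite !XE.
  have ij : i = j.
    apply/val_inj/eqP; rewrite /= -(nth_uniq setT _ _ uLs) ?sLs //.
    exact/eqP.
  by rewrite ij jG in iG.
have [N hN hd] := slots_moduli n8 dB lt; exists N => // L /surj[i <-].
by exists (d i), (v i).
Qed.

(** * The search *)

Definition pt := (N * N)%type.
(* The box [(d, v)] stands for the lattice [Lam d v]. *)
Definition box := (N * pt)%type.

(** Divisibility of [det] by [d], written as a congruence of two products because [N] has no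
    negative numbers. *)
Definition sim (d : N) (v w : pt) : bool :=
  N.eqb (N.modulo (v.1 * w.2)%num d) (N.modulo (v.2 * w.1)%num d).

Definition range (n : nat) : seq N := [seq N.of_nat i | i <- iota 0 n].

(* Every class of primitive vectors modulo 7, 10, 18, 24, 27 and 64 has a
   representative in [grid]. *)
Definition grid : seq pt :=
  [seq (1, b)%num | b <- range 64] ++
  [seq (a, 1)%num | a <- range 64 & ~~ N.eqb a 1] ++
  [:: (2, 3); (3, 2); (3, 4); (4, 3); (3, 8); (8, 3); (2, 9); (9, 2);
      (2, 5); (5, 2); (4, 5); (5, 4); (4, 9); (9, 4); (2, 15); (15, 2)]%num.

(** The choice depends on [d] and the class of [v] modulo [d], not on the modulus being searched, so
    a lattice found under several moduli is the same box each time. The default is not reached for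
    [v] in [grid]. *)
Definition canon (d : N) (v : pt) : pt := nth (0, 0)%num grid (find (sim d v) grid).

Fixpoint reps (T : Type) (r : T -> T -> bool) (n : nat) (s : seq T) : seq T :=
  if n isn't n'.+1 then [::] else
  if s isn't x :: _ then [::] else x :: reps r n' [seq y <- s | ~~ r x y].

Definition group (T : Type) (r : T -> T -> bool) (s : seq T) : seq (seq T) :=
  [seq [seq y <- s | r x y] | x <- reps r (size s) s].

(* Grouping by the successive moduli lists the points of P^1(Z/m) as the leaves
   of a tree; the search below is much faster in this order. *)
Definition points (m : N) (ds : seq N) : seq pt :=
  foldr (fun d P => flatten (group (sim d) P))
    [seq w <- grid | canon m w == w] ds.

(* Subsets of a list of points are encoded by the bits of a binary number. *)
Definition bits (f : pt -> bool) (P : seq pt) : N :=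
  foldr (fun w m => if f w then N.succ_double m else N.double m) 0%num P.

Definition divides (d m : N) : bool := N.eqb (N.modulo m d) 0.
Definition divs (m : N) : seq N :=
  [seq d <- behead (range (N.to_nat m).+1) | divides d m].
Definition small_primes : seq N := [:: 2; 3; 5; 7]%num.

(* A box, the points in it, and the points in those of its descendants that
   contain [v]. *)
Definition cell := (box * N * seq N)%type.
Definition cell_at (m : N) (P : seq pt) (v : pt) (d : N) : cell :=
  ((d, canon d v), bits (sim d v) P,
   [seq bits (sim (d * p)%num v) P | p <- small_primes & divides (d * p)%num m]).
Definition cells (m : N) (P : seq pt) (v : pt) : seq cell :=
  [seq cell_at m P v d | d <- divs m].

Definition isz (n : N) : bool := if n is N0 then true else false.
Fixpoint low_bit_pos (p : positive) : nat :=
  if p is xO q then (low_bit_pos q).+1 else 0.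
Definition low_bit (n : N) : nat := if n is Npos p then low_bit_pos p else 0.

Definition descendant_bits (d : N) (r : seq cell) : seq N :=
  (nth (0%num, (0, 0)%num, 0%num, [::]) r (find (fun b : cell => N.eqb b.1.1.1 d) r)).2.

(* [c2] encodes the points lying in at least two of the chosen boxes; no proper
   sublattice of [b] may contain all the points that only [b] covers. *)
Definition irreplaceable (tab : seq (seq cell)) (c2 : N) (b : cell) : bool :=
  let pr := N.ldiff b.1.2 c2 in
  if isz pr then false else
  all (fun s => ~~ isz (N.ldiff pr s))
    (descendant_bits b.1.1.1 (nth [::] tab (low_bit pr))).

(* [U] encodes the points that are not yet covered; the first of them is covered
   next. *)
Fixpoint search (tab : seq (seq cell)) (k : nat) (acc : seq cell) (c2 U : N) :
  seq (seq box) :=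
  if isz U then [:: [seq b.1.1 | b <- acc]] else
  if k isn't k'.+1 then [::] else
  flatten [seq
    (let c2' := N.lor c2 (N.ldiff b.1.2 U) in
     if all (irreplaceable tab c2') (b :: acc)
     then search tab k' (b :: acc) c2' (N.ldiff U b.1.2) else [::])
   | b <- nth [::] tab (low_bit U)].

(** A cocyclic lattice through a given point is determined by its index, so each row needs one box
    per divisor of [m]. *)
Definition table_of (m : N) (P : seq pt) : seq (seq cell) :=
  [seq cells m P v | v <- P].
Definition run (m : N) (P : seq pt) : seq (seq box) :=
  search (table_of m P) 8 [::] 0%num (bits predT P).

Definition moduli : seq (N * seq N) :=
  [:: (7, [:: 7]); (10, [:: 2; 5]); (27, [:: 3; 9; 27]); (18, [:: 3; 9; 2]);
      (24, [:: 2; 3; 4; 8]); (64, [:: 2; 4; 8; 16; 32; 64])]%num.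

(** Digits in base 64: the coordinates occurring in [grid] are below 64. *)
Definition box_key (b : box) : N := ((b.1 * 64 + b.2.1) * 64 + b.2.2)%num.
Definition all_coverings : seq (seq box) :=
  undup (flatten [seq [seq sort (fun x y => N.leb (box_key x) (box_key y)) c
                      | c <- run x.1 (points x.1 x.2)] | x <- moduli]).
Definition table : seq (seq box) := Eval vm_compute in all_coverings.
Lemma tableE : all_coverings = table. Proof. vm_cast_no_check (erefl table). Qed.
(* Otherwise simplification would unfold the 923 coverings. *)
Opaque table.

(** The last check runs over all residue pairs: one that is proportional to no listed point must
    share a prime with [m], and is then not the residue of a primitive vector. *)
Definition good_points (m : N) (P : seq pt) : bool :=
  [&& all (fun w => w \in grid) P,
      all (fun p => p \in [seq N.to_nat q | q <- small_primes]) (primes (N.to_nat m)) &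
      all (fun a => all (fun b => has (sim m (a, b)) P ||
          has (fun p => [&& divides p m, divides p a & divides p b]) small_primes)
        (range (N.to_nat m))) (range (N.to_nat m))].
Lemma moduli_points : all (fun x => good_points x.1 (points x.1 x.2)) moduli.
Proof. by vm_cast_no_check (erefl true). Qed.
Lemma grid_coprime : all (fun w : pt => coprime (N.to_nat w.1) (N.to_nat w.2)) grid.
Proof. by vm_compute. Qed.

(** * Correctness of the search *)

Lemma N_eqbE (a b : N) : N.eqb a b = (N.to_nat a == N.to_nat b).
Proof. by apply/idP/eqP => [/N.eqb_eq->|/N2Nat.inj->] //; rewrite N.eqb_refl. Qed.

Lemma to_nat_mul (a b : N) : N.to_nat (a * b)%num = (N.to_nat a * N.to_nat b)%N.
Proof. by rewrite N2Nat.inj_mul. Qed.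

Lemma to_nat_mod (a b : N) : N.to_nat (N.modulo a b) = (N.to_nat a %% N.to_nat b)%N.
Proof.
case: (N.eqb_spec b 0) => [->|b0]; first by case: a.
have lt := N.mod_lt a b b0; have e := N.div_mod' a b.
rewrite [in RHS]e N2Nat.inj_add to_nat_mul mulnC modnMDl modn_small //.
by apply/ltP; move: lt; clear; lia.
Qed.

Lemma dividesE d m : divides d m = (N.to_nat d %| N.to_nat m)%N.
Proof. by rewrite /divides N_eqbE to_nat_mod. Qed.

Definition zpt (w : pt) : Z2 := ((N.to_nat w.1)%:Z, (N.to_nat w.2)%:Z).
Definition blat (b : box) : set Z2 := Lam (N.to_nat b.1) (zpt b.2).

Lemma simE d v w : sim d v w = (N.to_nat d %| det (zpt v) (zpt w))%Z.
Proof.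
rewrite /sim N_eqbE !to_nat_mod !to_nat_mul /det /zpt /= -!PoszM.
by rewrite -eqz_mod_dvd !modz_nat eqz_nat.
Qed.

Lemma grid_primitive w : w \in grid -> primitive (zpt w).
Proof. by move=> h; have := allP grid_coprime w h. Qed.

Lemma canon_grid d v : v \in grid ->
  canon d v \in grid /\ Lam (N.to_nat d) (zpt v) (zpt (canon d v)).
Proof.
move=> h; have hs : has (sim d v) grid.
  by apply/hasP; exists v => //; rewrite simE det_refl dvdz0.
split; first by rewrite mem_nth // -has_find.
by have := nth_find (0, 0)%num hs; rewrite -/(canon d v) simE.
Qed.

Lemma canon_eq d v w : v \in grid -> w \in grid ->
  Lam (N.to_nat d) (zpt v) (zpt w) -> canon d v = canon d w.
Proof.
move=> hv hw h; have pv := grid_primitive hv; have pw := grid_primitive hw.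
rewrite /canon; congr nth; apply: eq_find => x.
have e := Lam_eq pv pw h; rewrite !simE; apply/idP/idP => hx.
  by have : Lam (N.to_nat d) (zpt v) (zpt x) by []; rewrite e.
by have : Lam (N.to_nat d) (zpt w) (zpt x) by []; rewrite -e.
Qed.

Definition tb (n : N) (j : nat) : bool := N.testbit n (N.of_nat j).

Lemma tb_bits f P j : tb (bits f P) j = (j < size P)%N && f (nth (0, 0)%num P j).
Proof.
rewrite /tb; elim: P j => [|w P IH] j; first by rewrite N.bits_0.
have nn (x : N) : (0 <= x)%num by exact: N.le_0_l.
case: j => [|j] /=.
  case: (f w); rewrite ?N.succ_double_spec ?N.double_spec.
    by rewrite N.testbit_odd_0.
  by rewrite N.testbit_even_0.
rewrite -[N.pos _]/(N.of_nat j.+1) Nat2N.inj_succ.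
case: (f w); rewrite ?N.succ_double_spec ?N.double_spec.
  by rewrite N.testbit_odd_succ // IH.
by rewrite N.testbit_even_succ // IH.
Qed.

Lemma tb_ldiff a b j : tb (N.ldiff a b) j = tb a j && ~~ tb b j.
Proof. exact: N.ldiff_spec. Qed.
Lemma tb_lor a b j : tb (N.lor a b) j = tb a j || tb b j.
Proof. exact: N.lor_spec. Qed.

Lemma tb_low_bit n : ~~ isz n -> tb n (low_bit n).
Proof.
case: n => // p _; rewrite /tb; elim: p => [//|p IH|//].
have -> : low_bit (N.pos p~0) = (low_bit (N.pos p)).+1 by [].
rewrite -[N.pos p~0]/(N.double (N.pos p)).
by rewrite Nat2N.inj_succ N.double_spec N.testbit_even_succ //; exact: N.le_0_l.
Qed.

Lemma iszP n : reflect (forall j, ~~ tb n j) (isz n).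
Proof.
apply: (iffP idP) => [|h]; first by case: n => // _ j; rewrite /tb N.bits_0.
by case: (boolP (isz n)) => // /tb_low_bit; rewrite (negbTE (h _)).
Qed.

Lemma mem_divs m d : (0 < N.to_nat m)%N -> divides d m -> d \in divs m.
Proof.
rewrite mem_filter => m0 dm; rewrite dm /=.
have d0 : (0 < N.to_nat d)%N by move: dm; rewrite dividesE; exact: dvdn_gt0.
have dle : (N.to_nat d <= N.to_nat m)%N by apply: dvdn_leq; rewrite -?dividesE.
rewrite /range /=.
apply/mapP; exists (N.to_nat d); last by rewrite N2Nat.id.
by rewrite mem_iota d0.
Qed.

Lemma divs_sub m d : (0 < N.to_nat m)%N -> d \in divs m ->
  (0 < N.to_nat d)%N /\ divides d m.
Proof. by rewrite mem_filter => m0 /andP[dm _]; split=> //; move: dm; rewrite dividesE; exact: dvdn_gt0. Qed.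

Lemma descendant_bitsE m P v d : d \in divs m ->
  descendant_bits d (cells m P v) =
  [seq bits (sim (d * p)%num v) P | p <- small_primes & divides (d * p)%num m].
Proof.
rewrite /descendant_bits /cells; elim: (divs m) => // e l IH.
have [->|ne] := eqVneq d e; first by rewrite map_cons [find _ _]/= N.eqb_refl.
rewrite inE (negbTE ne) => /IH; rewrite map_cons [find _ (_ :: _)]/=.
by case: N.eqb_spec => // e1; rewrite e1 eqxx in ne.
Qed.

Definition good_model (m : N) (P : seq pt) : Prop :=
  [/\ (0 < N.to_nat m)%N, {subset P <= grid},
      forall p, prime p -> (p %| N.to_nat m)%N -> exists2 q, q \in small_primes & N.to_nat q = p &
      forall v, primitive v -> exists2 j, (j < size P)%N &
        Lam (N.to_nat m) v (zpt (nth (0, 0)%num P j))].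

Lemma mem_range a n : (N.to_nat a < n)%N -> a \in range n.
Proof.
by move=> h; apply/mapP; exists (N.to_nat a); rewrite ?N2Nat.id // mem_iota.
Qed.

Lemma small_prime q : q \in small_primes -> prime (N.to_nat q).
Proof. by rewrite !inE => /or4P[]/eqP->. Qed.

Lemma good_pointsP m P : (0 < N.to_nat m)%N -> good_points m P -> good_model m P.
Proof.
move=> m0 /and3P[/allP sub /allP pr /allP h]; split=> //.
  move=> p pp pm; have : p \in primes (N.to_nat m) by rewrite mem_primes pp m0.
  by move/pr/mapP => [q hq ->]; exists q.
move=> v pv; have mz : (N.to_nat m)%:Z != 0 by rewrite eqz_nat -lt0n.
have red (x : int) : exists2 a, a \in range (N.to_nat m) & ((N.to_nat m)%:Z %| x - (N.to_nat a)%:Z)%Z.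
  have := modz_ge0 x mz; have := ltz_pmod x (_ : 0 < (N.to_nat m)%:Z).
  rewrite ltz_nat m0 => /(_ isT); case E : (x %% _)%Z => [i|//] hi _.
  exists (N.of_nat i); rewrite ?Nat2N.id -?E; first by apply: mem_range; rewrite Nat2N.id.
  by rewrite -eqz_mod_dvd modz_mod.
have [a ha ea] := red v.1; have [b hb eb] := red v.2.
have := allP (h a ha) b hb => /orP[/hasP[w wP]|/hasP[p /small_prime pp /and3P[]]].
  rewrite simE => hs; exists (index w P); rewrite ?index_mem // nth_index //.
  rewrite /Lam /= (_ : det v (zpt w) = det (zpt (a, b)) (zpt w) +
     ((v.1 - (N.to_nat a)%:Z) * (zpt w).2 - (v.2 - (N.to_nat b)%:Z) * (zpt w).1)).
    by rewrite rpredD // rpredB // dvdz_mulr.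
  by rewrite /det /=; ring.
rewrite !dividesE => pm pa pb.
have key (x : int) c : ((N.to_nat m)%:Z %| x - (N.to_nat c)%:Z)%Z -> (N.to_nat p %| N.to_nat c)%N ->
    ((N.to_nat p)%:Z %| x)%Z.
  move=> h1 h2; rewrite -[x](subrK (N.to_nat c)%:Z) rpredD //.
  exact: dvdz_trans h1.
have : ((N.to_nat p)%:Z %| gcdz v.1 v.2)%Z by rewrite dvdz_gcd (key _ a) // (key _ b).
by move: pv; rewrite /primitive /coprimez => /eqP ->; rewrite dvdz1 => /eqP /= h1; rewrite h1 in pp.
Qed.

(* [acc], [c2] and [U] as in [search]. *)
Definition search_inv (m : N) (P : seq pt) (acc : seq cell) (c2 U : N) : Prop :=
  [/\ forall b, b \in acc -> exists v d, [/\ v \in P, d \in divs m & b = cell_at m P v d],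
      forall j, tb U j = (j < size P)%N && (count (fun b => tb b.1.2 j) acc == 0%N) &
      forall j, tb c2 j = (1 < count (fun b => tb b.1.2 j) acc)%N].

Definition cset (c : seq box) : set (set Z2) := [set` [seq blat b | b <- c]].

Section Search.
Variables (m : N) (P : seq pt).
Hypothesis gm : good_model m P.
Let m0 : (0 < N.to_nat m)%N. Proof. by case: gm. Qed.
Let point j := nth (0, 0)%num P j.

Lemma point_grid j : (j < size P)%N -> point j \in grid.
Proof. by case: gm => _ h _ _ jP; apply/h/mem_nth. Qed.

Lemma search_inv0 : search_inv m P [::] 0%num (bits predT P).
Proof. by split=> // j; rewrite ?tb_bits ?andbT // /tb N.bits_0. Qed.

(** A listed point of the new box that is not in [U] was covered before, so it is now covered at
    least twice. *)
Lemma search_inv_step acc c2 U v d : v \in P -> d \in divs m ->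
  search_inv m P acc c2 U -> let b := cell_at m P v d in
  search_inv m P (b :: acc) (N.lor c2 (N.ldiff b.1.2 U)) (N.ldiff U b.1.2).
Proof.
move=> vP dm [hacc hU hc] b; split.
- by move=> b'; rewrite inE => /orP[/eqP->|/hacc//]; exists v, d.
- by move=> j; rewrite tb_ldiff hU /=; case: (tb _ j); rewrite /= ?andbF ?andbT.
- move=> j; rewrite tb_lor tb_ldiff hU hc /b /= tb_bits.
  case: (ltnP j (size P)) => jP /=; last by rewrite orbF add0n.
  by case: (sim _ _ _) => /=; rewrite ?orbF //; case: (count _ _) => [|[]].
Qed.

Lemma cell_point v d j : v \in P -> d \in divs m -> (j < size P)%N ->
  tb (cell_at m P v d).1.2 j <-> blat (cell_at m P v d).1.1 (zpt (point j)).
Proof.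
move=> vP dm jP; rewrite /= tb_bits jP simE /= /blat /=.
have [_ sub _ _] := gm; have [cg h] := canon_grid d (sub v vP).
by rewrite -(Lam_eq (grid_primitive (sub v vP)) (grid_primitive cg) h).
Qed.
End Search.

Lemma count_uniq_le1 (T U : eqType) (f : T -> U) (p : pred T) (y : U) (s : seq T) :
  uniq (map f s) -> (forall x, x \in s -> p x -> f x = y) -> (count p s <= 1)%N.
Proof.
move=> us h; apply: (@leq_trans (count_mem y (map f s))).
  rewrite count_map; elim: s h {us} => //= x s IH h; apply: leq_add.
    by case E : (p x); rewrite // (h x) ?mem_head ?eqxx.
  by apply: IH => z zs; apply: h; rewrite inE zs orbT.
by rewrite count_uniq_mem // leq_b1.
Qed.

Lemma count_two (T : eqType) (p : pred T) (x y : T) (s : seq T) :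
  x \in s -> y \in s -> x != y -> p x -> p y -> (1 < count p s)%N.
Proof.
move=> xs ys xy px py; have := perm_to_rem xs => /permP ->; rewrite /= px ltnS -has_count.
by apply/hasP; exists y => //; move: ys; rewrite (perm_mem (perm_to_rem xs)) inE eq_sym (negbTE xy).
Qed.

Section SearchCorrect.
Variables (m : N) (P : seq pt).
Hypothesis gm : good_model m P.
Let m0 : (0 < N.to_nat m)%N. Proof. by case: gm. Qed.
Let point j := nth (0, 0)%num P j.
Let tab := table_of m P.

Lemma cell_blat v d : v \in P -> blat (cell_at m P v d).1.1 = Lam (N.to_nat d) (zpt v).
Proof.
have [_ sub _ _] := gm => vP; have [cg h] := canon_grid d (sub v vP).
by apply: esym; exact: (Lam_eq (grid_primitive (sub v vP)) (grid_primitive cg) h).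
Qed.

(** Lattices of index dividing [m] cannot tell a primitive vector from the listed point that
    represents it modulo [m]. *)
Lemma point_transfer d v w x : (d %| N.to_nat m)%N -> primitive w ->
  Lam (N.to_nat m) w x -> Lam d v w -> Lam d v x.
Proof. by move=> dm pw h hv; apply: (Lam_trans pw hv); apply: Lam_dvd h. Qed.

Lemma point_primitive j : (j < size P)%N -> primitive (zpt (point j)).
Proof. by move=> jP; apply: grid_primitive; apply: (point_grid gm). Qed.

Lemma tab_nth j : (j < size P)%N -> nth [::] tab j = cells m P (point j).
Proof. by move=> jP; rewrite (nth_map (0, 0)%num). Qed.

Lemma point_mem j : (j < size P)%N -> point j \in P.
Proof. exact: mem_nth. Qed.

Section Complete.
Variables (C : set (set Z2)).
Hypothesis mC : minimal C.
Hypothesis CL : forall L, C L -> exists d v,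
  [/\ (0 < d)%N, (d %| N.to_nat m)%N, primitive v & L = Lam d v].

(** A vector private to [b] in all of [C] is private among the boxes chosen so far, and so is the
    point representing it. Hence the test never rejects a part of a minimal covering. *)
Lemma irreplaceable_minimal acc c2 U b : search_inv m P acc c2 U ->
  (forall b, b \in acc -> C (blat b.1.1)) -> uniq [seq blat b.1.1 | b <- acc] ->
  b \in acc -> irreplaceable tab c2 b.
Proof.
move=> [hacc hU hc] accC uacc bacc.
have [v [d [vP dm eb]]] := hacc b bacc.
have [_ sub _ complete] := gm; have pv := grid_primitive (sub v vP).
have [d0 ddm] := divs_sub m0 dm.
have CLb : C (Lam (N.to_nat d) (zpt v)) by rewrite -(cell_blat d vP) -eb; exact: accC.
pose pr := N.ldiff b.1.2 c2.
have key q z : (1 < q)%N -> primitive z -> Lam (N.to_nat d) (zpt v) z ->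
    exists j, [/\ (j < size P)%N, tb pr j &
      (N.to_nat d * q %| N.to_nat m)%N -> ~ Lam (N.to_nat d * q) z (zpt (point j))].
  move=> q1 pz Lz.
  have dq0 : (0 < N.to_nat d * q)%N by rewrite muln_gt0 d0 ltnW.
  have lt : Lam (N.to_nat d * q) z `<` Lam (N.to_nat d) (zpt v).
    split; first by apply: Lam_sub; rewrite ?dvdn_mulr.
    move/(Lam_subP pv pz) => [/dvdn_leq h _]; have := h d0.
    by rewrite leqNgt ltn_Pmulr.
  have [w [pw Lw nw priv]] := minimal_private mC CLb pv pz dq0 lt.
  have [j jP wj] := complete w pw; exists j; split=> //; last first.
    move=> dqm h; apply: nw; apply: (point_transfer dqm (point_primitive jP)) h.
    exact: Lam_sym.
  rewrite tb_ldiff hc -leqNgt eb; apply/andP; split.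
    apply/(cell_point gm) => //; rewrite cell_blat //.
    by apply: point_transfer wj Lw => //; rewrite -dividesE.
  apply: (count_uniq_le1 (f := fun b : cell => blat b.1.1) (y := Lam (N.to_nat d) (zpt v))) => //.
  move=> b' b'acc; have [v' [d' [v'P d'm eb']]] := hacc b' b'acc.
  rewrite eb' => /(cell_point gm v'P d'm jP); rewrite -eb' => hj.
  apply: contrapT => ne; apply: (priv _ (accC b' b'acc) ne).
  move: hj; rewrite eb' cell_blat // => hj.
  apply: (point_transfer _ (point_primitive jP)) hj; last exact: Lam_sym.
  by rewrite -dividesE; case: (divs_sub m0 d'm).
rewrite /irreplaceable -/pr.
(* The value 2 merely serves to produce some private point. A sublattice containing all private
   points contains the first one, [i0], so only descendants through [i0] are tested. *)
have [j0 [_ tj0 _]] := key 2%N (zpt v) isT pv (Lam_refl _ _).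
case: (iszP pr) => [/(_ j0)|_]; first by rewrite tj0.
have npr : ~~ isz pr by apply/iszP => /(_ j0); rewrite tj0.
have := tb_low_bit npr; set i0 := low_bit pr => ti0.
have [i0P Li0] : (i0 < size P)%N /\ Lam (N.to_nat d) (zpt v) (zpt (point i0)).
  move: ti0; rewrite tb_ldiff eb => /andP[ti0 _].
  have i0P : (i0 < size P)%N by move: ti0; rewrite tb_bits => /andP[].
  by split=> //; rewrite -(cell_blat d vP); apply/(cell_point gm).
rewrite tab_nth // eb descendant_bitsE //; apply/allP => s /mapP[q].
rewrite mem_filter => /andP[dqm /small_prime/prime_gt1 q1] ->.
have [j [jP tj nj]] := key _ _ q1 (point_primitive i0P) Li0.
apply/iszP => /(_ j); rewrite tb_ldiff tj negbK tb_bits jP simE /= to_nat_mul.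
by apply: nj; rewrite -to_nat_mul -dividesE.
Qed.

(** A lattice of [C] not yet chosen would have a private vector, but the point representing it is
    already covered by a chosen one. *)
Lemma leaf_complete Ls acc c2 U R : uniq Ls -> [set` Ls] = C ->
  search_inv m P acc c2 U -> perm_eq ([seq blat b.1.1 | b <- acc] ++ R) Ls ->
  isz U -> cset [seq b.1.1 | b <- acc] = C.
Proof.
move=> uLs eLs [hacc hU hc] pm /iszP Uz; have [_ _ _ complete] := gm.
have CE L : C L <-> L \in Ls by rewrite -eLs.
have accC b : b \in acc -> C (blat b.1.1).
  by move=> bacc; apply/CE; rewrite -(perm_mem pm) mem_cat (map_f (fun b : cell => blat b.1.1) bacc).
have uR : uniq ([seq blat b.1.1 | b <- acc] ++ R) by rewrite (perm_uniq pm).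
suff R0 : R = [::].
  rewrite /cset -map_comp -eLs; apply/seteqP.
  by rewrite R0 cats0 in pm; split=> L /=; rewrite (perm_mem pm).
case: R pm uR => // L R pm uR; exfalso.
have CL0 : C L by apply/CE; rewrite -(perm_mem pm) mem_cat mem_head orbT.
have [d [v [d0 dm pv eL]]] := CL CL0.
have lt : Lam (d * 2) v `<` Lam d v.
  split; first by apply: Lam_dvd; rewrite dvdn_mulr.
  by move/(Lam_subP pv pv) => [/dvdn_leq h _]; have := h d0; rewrite leqNgt ltn_Pmulr.
have [||w [pw Lw _ priv]] := @minimal_private C d v (d * 2) v mC _ pv pv _ lt.
- by rewrite -eL.
- by rewrite muln_gt0 d0.
have [j jP wj] := complete w pw.
have := Uz j; rewrite hU jP /= -lt0n -has_count => /hasP[b bacc].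
have [v' [d' [v'P d'm eb']]] := hacc b bacc.
rewrite eb' => /(cell_point gm v'P d'm jP); rewrite -eb' => hj.
apply: (priv _ (accC b bacc)); last first.
  move: hj; rewrite eb' cell_blat // => hj.
  apply: (point_transfer _ (point_primitive jP)) hj; last exact: Lam_sym.
  by rewrite -dividesE; case: (divs_sub m0 d'm).
rewrite -eL => e; move: uR; rewrite cat_uniq => /and3P[_ /hasPn/(_ L) + _].
by rewrite mem_head -e (map_f (fun b : cell => blat b.1.1) bacc) => /(_ isT).
Qed.

(** The branch to follow takes, for the first uncovered point, a member of [C] containing it; [R]
    holds the members still to be chosen and bounds the depth needed. *)
Lemma search_complete Ls k acc c2 U R : uniq Ls -> [set` Ls] = C ->
  search_inv m P acc c2 U -> perm_eq ([seq blat b.1.1 | b <- acc] ++ R) Ls ->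
  (size R <= k)%N ->
  exists2 c, c \in search tab k acc c2 U & cset c = C.
Proof.
move=> uLs eLs; have CE L : C L <-> L \in Ls by rewrite -eLs.
have [_ sub _ complete] := gm.
have uncovered acc' c2' U' L : search_inv m P acc' c2' U' -> ~~ isz U' ->
    L (zpt (point (low_bit U'))) -> L \notin [seq blat b.1.1 | b <- acc'].
  move=> [hacc hU _] /tb_low_bit; rewrite hU => /andP[jP /eqP nj] hL.
  apply/mapP => -[b bacc eL]; have [v' [d' [v'P d'm eb']]] := hacc b bacc.
  have : has (fun b : cell => tb b.1.2 (low_bit U')) acc'.
    apply/hasP; exists b => //; rewrite eb'; apply/(cell_point gm) => //.
    by rewrite -eb' -eL.
  by rewrite has_count nj.
elim: k acc c2 U R => [|k IH] acc c2 U R inv pm szR /=.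
  move: szR; rewrite leqn0 size_eq0 => /eqP R0.
  case: (boolP (isz U)) => Uz.
    by eexists; [exact: mem_head | exact: leaf_complete inv pm Uz].
  have [L /CE LC hL] := coveringE (zpt (point (low_bit U))) mC.1.
  have := uncovered _ _ _ _ inv Uz hL.
  by move: LC; rewrite -(perm_mem pm) R0 cats0 => ->.
case: ifPn => Uz.
  by eexists; [exact: mem_head | exact: leaf_complete inv pm Uz].
have jP : (low_bit U < size P)%N.
  by have [_ hU _] := inv; move: (tb_low_bit Uz); rewrite hU => /andP[].
have [L CL0 hL] := coveringE (zpt (point (low_bit U))) mC.1.
have nacc := uncovered _ _ _ _ inv Uz hL.
have LR : L \in R.
  by move/CE: (CL0); rewrite -(perm_mem pm) mem_cat (negbTE nacc).
have [d [v [d0 dm pv eL]]] := CL CL0.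
pose D := N.of_nat d; have eD : N.to_nat D = d by rewrite Nat2N.id.
have Dm : D \in divs m by apply: mem_divs => //; rewrite dividesE eD.
pose b := cell_at m P (point (low_bit U)) D.
have bL : blat b.1.1 = L.
  rewrite cell_blat ?point_mem // eD eL; apply: esym; apply: Lam_eq => //.
    exact: point_primitive.
  by rewrite -eL.
have inv' := search_inv_step (point_mem jP) Dm inv; rewrite -/b /= in inv'.
have pm' : perm_eq ([seq blat b.1.1 | b <- b :: acc] ++ rem L R) Ls.
  apply: perm_trans pm; rewrite /= bL perm_sym.
  apply: (@perm_trans _ ([seq blat b.1.1 | b <- acc] ++ [:: L] ++ rem L R)).
    by rewrite perm_cat2l perm_to_rem.
  by rewrite perm_catCA.
have [|c hc' eC] := IH _ _ _ _ inv' pm'.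
  by rewrite size_rem //; move: szR; case: (R) LR.
have allb : all (irreplaceable tab (N.lor c2 (N.ldiff b.1.2 U))) (b :: acc).
  apply/allP => b'; apply: (irreplaceable_minimal inv').
    by move=> b0 hb0; apply/CE; rewrite -(perm_mem pm') mem_cat (map_f (fun b : cell => blat b.1.1) hb0).
  by move: (perm_uniq pm'); rewrite uLs cat_uniq => /and3P[].
exists c => //; apply/flattenP.
exists (search tab k (b :: acc) (N.lor c2 (N.ldiff b.1.2 U)) (N.ldiff U b.1.2)) => //.
apply/mapP; exists b; first by rewrite tab_nth // map_f.
by move: allb => /= ->.
Qed.
End Complete.
(** A sublattice [L'] replacing [b] contains all private points, hence lies in a descendant
    [Lam (d * p) z] through the first of them, [z], and [irreplaceable] excludes just these
    descendants. *)
Lemma leaf_sound acc c2 U : search_inv m P acc c2 U ->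
  all (irreplaceable tab c2) acc -> isz U -> minimal (cset [seq b.1.1 | b <- acc]).
Proof.
move=> [hacc hU hc] /allP irr /iszP Uz; have [_ sub small complete] := gm.
set C := cset _.
have CE L : C L <-> exists2 b, b \in acc & L = blat b.1.1.
  rewrite /C /cset /= -map_comp; split=> [/mapP[b bacc ->]|[b bacc ->]].
    by exists b.
  by apply/mapP; exists b.
have Cbox b : b \in acc -> exists v d, [/\ v \in P, d \in divs m, b = cell_at m P v d &
    blat b.1.1 = Lam (N.to_nat d) (zpt v)].
  by move=> /hacc[v [d [vP dm eb]]]; exists v, d; rewrite eb cell_blat.
have back b j w : b \in acc -> (j < size P)%N -> primitive w ->
    Lam (N.to_nat m) w (zpt (point j)) -> blat b.1.1 w <-> tb b.1.2 j.
  move=> bacc jP pw wj; have [v [d [vP dm eb eL]]] := Cbox b bacc.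
  have [_] := divs_sub m0 dm; rewrite dividesE => dvm.
  rewrite eL {1}eb; split.
    by move=> h; apply/(cell_point gm) => //; rewrite cell_blat //; apply: point_transfer wj h.
  move/(cell_point gm vP dm jP); rewrite cell_blat // => h.
  by apply: (point_transfer dvm (point_primitive jP)) h; exact: Lam_sym.
have latC : C `<=` lattice.
  move=> L /CE[b bacc ->]; have [v [d [vP dm eb ->]]] := Cbox b bacc.
  by apply: lattice_Lam; [case: (divs_sub m0 dm) | exact: grid_primitive (sub v vP)].
split.
  apply: covering_primitive => //; first exact: finite_seq.
  move=> w pw; have [j jP wj] := complete w pw.
  have := Uz j; rewrite hU jP /= -lt0n -has_count => /hasP[b bacc tj].
  by exists (blat b.1.1); [apply/CE; exists b | apply/(back b j)].
move=> L L' /CE[b bacc ->] lL' [subL nsubL] cov.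
have := irr b bacc; rewrite /irreplaceable; set pr := N.ldiff b.1.2 c2.
case: ifPn => // npr; have := tb_low_bit npr; set i0 := low_bit pr => ti0.
have [v [d [vP dm eb eL]]] := Cbox b bacc.
have [d0] := divs_sub m0 dm; rewrite dividesE => ddm.
have only j w : tb pr j -> (j < size P)%N -> primitive w ->
    Lam (N.to_nat m) w (zpt (point j)) -> L' w.
  rewrite tb_ldiff hc => /andP[tj /negP n1] jP pw wj.
  have [M [->//|[/CE[b' b'acc ->] ne]] Mw] := coveringE w cov.
  case: n1; apply: (count_two bacc b'acc) => //.
    by apply/eqP => e; apply: ne; rewrite /= e.
  by apply/(back b' j w).
have ltP j : tb pr j -> (j < size P)%N.
  by rewrite tb_ldiff eb tb_bits => /andP[/andP[]].
have i0P := ltP i0 ti0; set z := point i0 in i0P *.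
have pz : primitive (zpt z) by apply: point_primitive.
have L'z : L' (zpt z) by apply: (only i0) => //; exact: Lam_refl.
have Lz : Lam (N.to_nat d) (zpt v) (zpt z) by rewrite -eL; apply: subL.
have pv := grid_primitive (sub v vP).
have [k k0 eL'] := lattice_primitive lL' pz L'z.
have dz : Lam (N.to_nat d) (zpt v) = Lam (N.to_nat d) (zpt z) by apply: Lam_eq.
rewrite eL dz eL' in subL nsubL.
have [/dvdnP[q ek] _] := Lam_subP pz pz subL.
have q1 : (1 < q)%N.
  case: q ek => [|[|//]] ek; first by rewrite ek in k0.
  by case: nsubL; rewrite ek mul1n.
have pp := pdiv_prime q1; have /dvdnP[r er] := pdiv_dvd q.
set p := pdiv q in pp er.
have kp : Lam k (zpt z) `<=` Lam (N.to_nat d * p) (zpt z).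
  by apply: Lam_dvd; rewrite ek er -mulnA [(p * _)%N]mulnC dvdn_mull.
have [u eu] := primitive_basis pz.
(* The test knows only descendants of index dividing [m]. This one is such: [z + m u] is in the
   class of [z] modulo [m], so it is private too and belongs to [L']. *)
have dpm : (N.to_nat d * p %| N.to_nat m)%N.
  have : L' (zpt z + u *~ (N.to_nat m)%:Z).
    apply: (only i0) => //.
      by apply: (@basis_primitive _ u); move: eu; rewrite /det pairMz => <- /=; ring.
    apply: Lam_sym; rewrite /Lam /= -/z detDr det_refl add0r detMr eu mul1r.
    exact: dvdzz.
  by rewrite eL' => /kp; rewrite /Lam /= detDr det_refl add0r detMr eu mul1r.
have [q' q'P eq'] : exists2 q', q' \in small_primes & N.to_nat q' = p.
  by apply: small => //; apply: dvdn_trans dpm; apply: dvdn_mull.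
move/allP => /(_ (bits (sim (d * q')%num z) P)).
rewrite tab_nth // eb descendant_bitsE // => /(_ _)/negP[].
  by apply: (map_f (fun q => bits (sim (d * q)%num z) P));
     rewrite mem_filter q'P dividesE to_nat_mul eq' dpm.
apply/iszP => j; rewrite tb_ldiff; apply/negP => /andP[tj].
have jP := ltP j tj; rewrite tb_bits jP simE /= to_nat_mul eq' => /negP; apply.
have : L' (zpt (point j)).
  by apply: (only j) => //; [exact: point_primitive | exact: Lam_refl].
by rewrite eL' => /kp.
Qed.

Lemma search_sound k acc c2 U c : search_inv m P acc c2 U ->
  all (irreplaceable tab c2) acc -> c \in search tab k acc c2 U ->
  minimal (cset c) /\
  forall b, b \in c -> exists v d, [/\ v \in P, d \in divs m & b = (d, canon d v)].
Proof.
elim: k acc c2 U => [|k IH] acc c2 U inv irr /=; case: ifPn => Uz //.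
1,2: rewrite inE => /eqP ->; split; first exact: leaf_sound inv irr Uz.
1,2: by move=> _ /mapP[b bacc ->]; have [/(_ b bacc)[v [d [vP dm ->]]]] := inv; exists v, d.
move=> /flattenP[cs /mapP[b hb ->]].
have jP : (low_bit U < size P)%N.
  by have [_ hU _] := inv; move: (tb_low_bit Uz); rewrite hU => /andP[].
move: hb; rewrite tab_nth // => /mapP[d dm eb].
case: ifP => // irr'; apply: (IH (b :: acc) _ _ _ irr'); rewrite eb.
exact: (search_inv_step (point_mem jP) dm inv).
Qed.
End SearchCorrect.

(** * Normal forms, and the table as the list of minimal coverings *)

Definition standard (b : box) : Prop :=
  [/\ b.2 \in grid, b.2 = canon b.1 b.2, (0 < N.to_nat b.1)%N &
    forall p, prime p -> (p %| N.to_nat b.1)%N ->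
      exists2 q, q \in small_primes & N.to_nat q = p].

Lemma standard_primitive b : standard b -> primitive (zpt b.2).
Proof. by case=> h _ _ _; apply: grid_primitive. Qed.

(** Boxes of the same lattice have equal indices and congruent vectors, and [canon] picks the same
    representative for both. *)
Lemma blat_inj b b' : standard b -> standard b' -> blat b = blat b' -> b = b'.
Proof.
case: b b' => [d v] [d' v'] sb sb' e.
have [] := Lam_inj (standard_primitive sb) (standard_primitive sb') e.
move=> /N2Nat.inj /= ed h; case: sb sb' => /= vg ev _ _ [/= v'g ev' _ _].
by congr (_, _) => //; rewrite ev ev' -ed; apply: canon_eq.
Qed.

Definition key_lt (x y : box) : bool := N.ltb (box_key x) (box_key y).
(** Strict order makes each entry free of repetitions and the only sorted list with its elements, so
    that equality of sets of lattices becomes equality of lists. *)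
Lemma table_sorted : all (sorted key_lt) table.
Proof. by vm_cast_no_check (erefl true). Qed.
Lemma table_uniq : uniq table.
Proof. by rewrite -tableE undup_uniq. Qed.

Lemma moduli_model x : x \in moduli -> good_model x.1 (points x.1 x.2).
Proof.
move=> hx; apply: good_pointsP (allP moduli_points x hx).
by move: hx; rewrite !inE => /or4P[|||/or3P[]] /eqP->.
Qed.

Lemma mem_tableE c : reflect
  (exists2 x, x \in moduli & exists2 c0, c0 \in run x.1 (points x.1 x.2) &
     c = sort (fun x y => N.leb (box_key x) (box_key y)) c0)
  (c \in table).
Proof.
rewrite -tableE mem_undup; apply: (iffP flattenP).
  by case=> s /mapP[x hx ->] /mapP[c0 hc ->]; exists x => //; exists c0.
case=> x hx [c0 hc ->]; eexists; first by apply/mapP; exists x.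
by apply/mapP; exists c0.
Qed.

Lemma cset_sort r c : cset (sort r c) = cset c.
Proof.
apply/seteqP; split=> L /mapP[b hb ->]; apply/mapP; exists b => //.
  by rewrite mem_sort in hb.
by rewrite mem_sort.
Qed.

Lemma table_complete n C : (n <= 8)%N -> minimal C -> C #= `I_n ->
  exists2 c, c \in table & cset c = C.
Proof.
move=> n8 mC Cn; have [N hN hC] := minimal_moduli n8 mC Cn.
have [x hx ex] : exists2 x, x \in moduli & N.to_nat x.1 = N.
  have : N \in [seq N.to_nat x.1 | x <- moduli] by exact: hN.
  by case/mapP => x hx ->; exists x.
have [Ls [uLs sLs eLs]] := finite_covering_seq Cn.
have gm := moduli_model hx.
have hC' L : C L -> exists d v,
    [/\ (0 < d)%N, (d %| N.to_nat x.1)%N, primitive v & L = Lam d v].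
  by rewrite ex; apply: hC.
have [||c hc e] := @search_complete _ _ gm C mC hC' Ls 8 [::] 0%num
   (bits predT (points x.1 x.2)) Ls uLs eLs (search_inv0 _ _).
- by rewrite perm_refl.
- by rewrite sLs.
exists (sort (fun x y => N.leb (box_key x) (box_key y)) c); last by rewrite cset_sort.
by apply/mem_tableE; exists x => //; exists c.
Qed.

Lemma table_minimal c : c \in table ->
  minimal (cset c) /\ forall b, b \in c -> standard b.
Proof.
case/mem_tableE => x hx [c0 hc ->]; have gm := moduli_model hx.
have [m0 sub small _] := gm.
have [min hb] := search_sound gm (search_inv0 x.1 (points x.1 x.2)) isT hc.
rewrite cset_sort; split=> // b; rewrite mem_sort => /hb[v [d [vP dm ->]]].
have [cg h] := canon_grid d (sub v vP); have [d0] := divs_sub m0 dm.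
rewrite dividesE => ddm; split=> //=; first by apply: canon_eq => //; exact: sub.
by move=> p pp pd; apply: small => //; apply: dvdn_trans ddm.
Qed.

Lemma key_lt_trans : transitive key_lt.
Proof. by move=> y x z /N.ltb_lt h1 /N.ltb_lt h2; apply/N.ltb_lt; apply: N.lt_trans h2. Qed.
Lemma key_lt_irr : irreflexive key_lt.
Proof. by move=> x; apply/negbTE/negP => /N.ltb_lt/N.lt_irrefl. Qed.

Lemma table_coverings_uniq c : c \in table -> uniq [seq blat b | b <- c].
Proof.
move=> hc; have [_ std] := table_minimal hc.
rewrite map_inj_in_uniq; last by move=> b b' hb hb'; apply: blat_inj; exact: std.
exact: (sorted_uniq key_lt_trans key_lt_irr (allP table_sorted c hc)).
Qed.

Lemma cset_inj : {in table &, injective cset}.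
Proof.
have sub c c' : c \in table -> c' \in table -> cset c = cset c' -> {subset c <= c'}.
  move=> hc hc' e b bc; have [_ s] := table_minimal hc; have [_ s'] := table_minimal hc'.
  have : cset c (blat b) by apply: map_f.
  rewrite e => /mapP[b' b'c' eb]; rewrite (blat_inj _ _ eb) //; [exact: s | exact: s'].
move=> c c' hc hc' e.
apply: (irr_sorted_eq key_lt_trans key_lt_irr (allP table_sorted c hc) (allP table_sorted c' hc')).
by move=> b; apply/idP/idP; apply: sub.
Qed.

Lemma cset_card c : c \in table -> cset c #= `I_(size c).
Proof. by move=> hc; rewrite card_eq_seq ?size_map // table_coverings_uniq. Qed.

Lemma minimal_of_sizeP n C : (n <= 8)%N ->
  minimal_of_size n C <-> exists c, [/\ c \in table, size c = n & C = cset c].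
Proof.
move=> n8; split=> [[mC Cn]|[c [hc sc ->]]].
  have [c hc e] := table_complete n8 mC Cn; exists c; split=> //.
  by apply/card_eq_II; rewrite -e in Cn; apply: card_eq_trans Cn; rewrite card_eq_sym cset_card.
by split; [case: (table_minimal hc) | rewrite -sc cset_card].
Qed.

Lemma card_table_set (p : pred (seq box)) (F : set (set (set Z2))) :
  (forall C, F C <-> exists c, [/\ c \in table, p c & C = cset c]) ->
  F #= `I_(count p table).
Proof.
move=> hF; rewrite (_ : F = [set` [seq cset c | c <- table & p c]]).
  rewrite card_eq_seq ?size_map ?size_filter // map_inj_in_uniq ?filter_uniq ?table_uniq //.
  by move=> c c'; rewrite !mem_filter => /andP[_ hc] /andP[_ hc']; apply: cset_inj.
apply/seteqP; split=> C.
  by case/hF => c [hc pc ->]; apply/mapP; exists c; rewrite // mem_filter pc.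
by case/mapP => c; rewrite mem_filter => /andP[pc hc] ->; apply/hF; exists c.
Qed.

(** * Index structures *)

Lemma perm_Permutation (T : eqType) (s t : seq T) :
  perm_eq s t -> Permutation.Permutation s t.
Proof.
elim: s t => [|x s IH] t; first by rewrite perm_sym => /perm_nilP ->.
move=> h; have xt : x \in t by rewrite -(perm_mem h) mem_head.
have := perm_trans h (perm_to_rem xt); rewrite perm_cons => /IH hp.
apply: (Permutation.perm_trans (Permutation.perm_skip x hp)).
elim: t xt {IH h hp} => //= y t IH; rewrite inE; case: (eqVneq y x) => [-> _|yx].
  exact: Permutation.Permutation_refl.
move=> /= /IH h.
exact: Permutation.perm_trans (Permutation.perm_swap _ _ _) (Permutation.perm_skip _ h).
Qed.

Lemma Permutation_perm (T : eqType) (s t : seq T) :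
  Permutation.Permutation s t -> perm_eq s t.
Proof.
elim=> {s t} [|x s t _ h|x y s|s t u _ h1 _ h2] //; first by rewrite perm_cons.
- by apply/permP => q /=; rewrite addnCA.
- exact: perm_trans h2.
Qed.

Lemma Forall2_perm (A B : Type) (R : A -> B -> Prop) s t t' :
  List.Forall2 R s t -> Permutation.Permutation t t' ->
  exists s', Permutation.Permutation s s' /\ List.Forall2 R s' t'.
Proof.
move=> /List.Forall2_flip h /Permutation.Permutation_Forall2 /(_ h) [s' [p h']].
by exists s'; split=> //; apply: List.Forall2_flip.
Qed.

Lemma istruct_ind' (P : istruct -> Prop) : (forall N, P (Kept N)) ->
  (forall ss, (forall s, List.In s ss -> P s) -> P (Refined ss)) -> forall s, P s.
Proof.
move=> hk hr; fix F 1 => -[N|ss]; first exact: hk.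
apply: hr; elim: ss => [|s ss IH] t; first by case.
by case=> [<-|]; [exact: F | exact: IH].
Qed.

Lemma Forall2_impl_in (A B : Type) (R R' : A -> B -> Prop) s t :
  (forall x y, List.In x s -> List.In y t -> R x y -> R' x y) ->
  List.Forall2 R s t -> List.Forall2 R' s t.
Proof.
move=> + h; elim: h => // x y s' t' hxy hs IH hR; constructor.
  by apply: hR hxy; left.
by apply: IH => a b ha hb; apply: hR; right.
Qed.

Lemma Forall2_trans_in (A B D : Type) (R : A -> B -> Prop) (S : B -> D -> Prop)
    (T : A -> D -> Prop) s t u :
  (forall x y z, List.In x s -> R x y -> S y z -> T x z) ->
  List.Forall2 R s t -> List.Forall2 S t u -> List.Forall2 T s u.
Proof.
move=> + h; elim: h u => [|x y s' t' hxy hs IH] u hT hu; inversion hu; subst; constructor.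
  by apply: hT hxy _ => //; left.
by apply: IH => // a b c ha; apply: hT; right.
Qed.

Lemma same_struct_sym s t : same_struct s t -> same_struct t s.
Proof.
elim/istruct_ind': s t => [N|ss IH] t h; inversion h as [|? ss' ss'' p f]; subst.
  by constructor.
have f' : List.Forall2 same_struct ss'' ss'.
  apply: List.Forall2_flip; apply: Forall2_impl_in f => x y xs _.
  by apply: IH; apply: Permutation.Permutation_in xs; apply: Permutation.Permutation_sym.
have [u [pu fu]] := Forall2_perm f' (Permutation.Permutation_sym p).
exact: same_refined pu fu.
Qed.

Lemma same_struct_trans s t u : same_struct s t -> same_struct t u -> same_struct s u.
Proof.
elim/istruct_ind': s t u => [N|ss IH] t u h; inversion h as [|? ss' ss'' p f]; subst => //.
move=> h2; inversion h2 as [|? ts' ts'' q g]; subst.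
have [v [pv fv]] := Forall2_perm f q.
apply: (@same_refined _ v); first exact: Permutation.perm_trans p pv.
apply: Forall2_trans_in fv g => x y z xv; apply: IH.
apply: Permutation.Permutation_in xv; apply: Permutation.Permutation_sym.
exact: Permutation.perm_trans p pv.
Qed.

Definition unions (DCs : seq (set Z2 * set (set Z2))) : set (set Z2) :=
  foldr (fun DC C => DC.2 `|` C) set0 DCs.

Lemma unionsP DCs M : unions DCs M <-> exists2 DC, DC \in DCs & DC.2 M.
Proof.
elim: DCs => [|DC DCs IH] /=; first by split=> // -[].
split=> [[h|/IH[DC' h1 h2]]|[DC']]; [by exists DC; rewrite ?mem_head | by exists DC'; rewrite ?inE ?h1 ?orbT|].
by rewrite inE => /orP[/eqP->|h1 h2]; [left | right; apply/IH; exists DC'].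
Qed.

Lemma realizes_allP ss DCs :
  List.Forall2 (fun s DC => realizes s DC.1 DC.2) ss DCs ->
  realizes_all ss [seq DC.1 | DC <- DCs] (unions DCs).
Proof. by elim=> {ss DCs} [|s [D C] ss DCs h _ IH] /=; constructor. Qed.

(** The mutual predicate [realizes_all] is replaced by [List.Forall2] over pairs of a descendant and
    the part of the covering below it, with an induction hypothesis for each pair. *)
Lemma realizes_ind' (P : istruct -> set Z2 -> set (set Z2) -> Prop) :
  (forall N L, cocyclic L -> index_is setT L N -> P (Kept N) L [set L]) ->
  (forall p ss L DCs, prime p -> cocyclic L ->
     enumerates [seq DC.1 | DC <- DCs] (descendants p L) ->
     List.Forall2 (fun s DC => realizes s DC.1 DC.2 /\ P s DC.1 DC.2) ss DCs ->
     P (Refined ss) L (unions DCs)) ->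
  forall s L C, realizes s L C -> P s L C.
Proof.
move=> hk hr; fix F 4 => s L C [N L' cL iL|p ss Ds L' C' pp cL eD hall]; first exact: hk.
suff [DCs [eDs eC fDC]] : exists DCs, [/\ [seq DC.1 | DC <- DCs] = Ds, unions DCs = C' &
    List.Forall2 (fun s DC => realizes s DC.1 DC.2 /\ P s DC.1 DC.2) ss DCs].
  by rewrite -eC; apply: (hr p) => //; rewrite eDs.
move: ss Ds C' hall {eD}; fix G 4 => ss Ds C' [|s1 ss1 D1 Ds1 C1 C1' h1 h2].
  by exists [::]; split.
have [DCs [<- <- fDC]] := G _ _ _ h2.
exists ((D1, C1) :: DCs); split=> //; constructor => //=; split=> //; exact: F.
Qed.

(** The descendants may be enumerated in any order, so they are permuted together with the
    entries. *)
Lemma same_struct_realizes s t L C : same_struct s t -> realizes s L C -> realizes t L C.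
Proof.
move=> + h; move: s L C h t; apply: realizes_ind' => [N L cL iL|p ss L DCs pp cL [u e] f] t h;
  inversion h as [|? ss' ss'' q g]; subst; first by constructor.
have [DCs' [pD fD]] := Forall2_perm (List.Forall2_flip f) q.
have pD' : perm_eq DCs DCs' by apply: Permutation_perm.
have -> : unions DCs = unions DCs'.
  by apply/seteqP; split=> M /unionsP[DC h1 h2]; apply/unionsP; exists DC; rewrite ?(perm_mem pD') // -(perm_mem pD').
have pm := perm_map fst pD'.
apply: (@realizes_refined p _ [seq DC.1 | DC <- DCs']) => //.
  split; first by rewrite -(perm_uniq pm).
  by rewrite -e; apply/seteqP; split=> M /=; rewrite (perm_mem pm).
apply: realizes_allP; have fD' := List.Forall2_flip fD.
elim: fD' ss'' g {h} => [|s1 DC ss1 DCs1 [_ h1] _ IH] ss'' g; inversion g; subst; constructor.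
  exact: h1.
exact: IH.
Qed.

Lemma descendantsP p n v D : (0 < p)%N -> (0 < n)%N -> primitive v ->
  descendants p (Lam n v) D <->
  exists w, [/\ primitive w, Lam n v w & D = Lam (n * p) w].
Proof.
move=> p0 n0 pv; split=> [[cD sD iD]|[w [pw vw ->]]].
  have [k [w [k0 pw eD]]] := (cocyclicP D).1 cD; rewrite eD in sD iD.
  have e := (index_LamP p n0 k0 pv pw sD).1 iD.
  by exists w; split=> //; [apply/sD/Lam_refl | rewrite eD e].
have np0 : (0 < n * p)%N by rewrite muln_gt0 n0.
have sub : Lam (n * p) w `<=` Lam n v by apply: Lam_sub => //; rewrite dvdn_mulr.
by split=> //; [exact: cocyclic_Lam | apply/index_LamP].
Qed.

Lemma descendants_disjoint p L D D' w : (0 < p)%N -> cocyclic L -> primitive w ->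
  descendants p L D -> descendants p L D' -> D w -> D' w -> D = D'.
Proof.
move=> p0 /cocyclicP[n [v [n0 pv ->]]] pw.
move=> /descendantsP[]// x [px _ ->] /descendantsP[]// y [py _ ->] hx hy.
by rewrite (Lam_eq px pw hx) (Lam_eq py pw hy).
Qed.

Lemma descendants_cover p L w : (0 < p)%N -> cocyclic L -> primitive w -> L w ->
  exists2 D, descendants p L D & D w.
Proof.
move=> p0 /cocyclicP[n [v [n0 pv ->]]] pw Lw; exists (Lam (n * p) w); last exact: Lam_refl.
by apply/descendantsP => //; exists w.
Qed.

(** * Exact tilings of the primitive vectors of a lattice *)

Definition tiling (L : set Z2) (C : set (set Z2)) : Prop :=
  [/\ finite_set C, C `<=` cocyclic, forall M, C M -> M `<=` L &
      forall w, primitive w -> L w -> exists! M, C M /\ M w].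

Fixpoint leaves (s : istruct) : nat :=
  match s with Kept _ => 1 | Refined ss => sumn [seq leaves t | t <- ss] end.

Lemma card_disjoint_union (A B : set (set Z2)) a b : A #= `I_a -> B #= `I_b ->
  A `&` B = set0 -> (A `|` B) #= `I_(a + b).
Proof.
move=> /finite_covering_seq[s [us <- es]] /finite_covering_seq[t [ut <- et]] dis.
rewrite (_ : _ `|` _ = [set` s ++ t]).
  rewrite card_eq_seq ?size_cat // cat_uniq us ut andbT /=; apply/hasPn => x xt.
  apply/negP => xs; have : set0 x by rewrite -dis -es -et.
  by [].
by rewrite -es -et; apply/seteqP; split=> x /=; rewrite mem_cat => /orP.
Qed.

(** The descendants of [L] partition its primitive vectors, so tilings of them combine to one of
    [L]. Sizes add up because a lattice in two parts would contain a primitive vector of two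
    descendants. *)
Lemma unions_tiling p ss L DCs : (0 < p)%N -> cocyclic L ->
  enumerates [seq DC.1 | DC <- DCs] (descendants p L) ->
  List.Forall2 (fun s DC => tiling DC.1 DC.2 /\ DC.2 #= `I_(leaves s)) ss DCs ->
  tiling L (unions DCs) /\ unions DCs #= `I_(leaves (Refined ss)).
Proof.
move=> p0 cL [uD eD] f.
have desc DC : DC \in DCs -> descendants p L DC.1 by move=> h; rewrite -eD; apply: map_f.
have til DC : DC \in DCs -> tiling DC.1 DC.2.
  elim: f {uD eD desc} => // s DC' ss' DCs' [h _] _ IH; rewrite inE => /orP[/eqP->//|]; exact: IH.
have same DC DC' : DC \in DCs -> DC' \in DCs -> DC.1 = DC'.1 -> DC = DC'.
  move=> h h' e; apply/eqP; rewrite -(nth_index DC h) -(nth_index DC h').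
  have i1 : (index DC DCs < size DCs)%N by rewrite index_mem.
  have i2 : (index DC' DCs < size DCs)%N by rewrite index_mem.
  suff -> : index DC DCs = index DC' DCs by [].
  apply/eqP; rewrite -(nth_uniq DC.1 _ _ uD) ?size_map // !(nth_map DC) //.
  by rewrite !nth_index // e.
have uni DC DC' M M' w : primitive w -> DC \in DCs -> DC' \in DCs -> DC.2 M -> DC'.2 M' ->
    M w -> M' w -> DC = DC'.
  move=> pw h h' hM hM' Mw M'w; apply: same => //.
  have [_ _ s _] := til _ h; have [_ _ s' _] := til _ h'.
  by apply: (descendants_disjoint p0 cL pw (desc _ h) (desc _ h')); [exact: s Mw | exact: s' M'w].
have card ss' DCs' :
    List.Forall2 (fun s DC => tiling DC.1 DC.2 /\ DC.2 #= `I_(leaves s)) ss' DCs' ->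
    uniq DCs' -> {subset DCs' <= DCs} -> unions DCs' #= `I_(sumn [seq leaves t | t <- ss']).
  elim=> {ss' DCs'} [|s DC ss' DCs' [tDC cDC] _ IH] /=; first by rewrite II0.
  move=> /andP[nDC uDCs'] sub; apply: card_disjoint_union => //.
    by apply: IH => // x hx; apply: sub; rewrite inE hx orbT.
  apply/seteqP; split=> // M [hM /unionsP[DC' h' hM']].
  have [_ coc _ _] := tDC; have [w pw Mw] := cocyclic_primitive (coc M hM).
  have e : DC = DC'.
    by apply: (uni _ _ M M w) => //; apply: sub; rewrite inE ?eqxx // h' orbT.
  by rewrite e h' in nDC.
have cU := card _ _ f (map_uniq uD) (fun x h => h).
split; last exact: cU.
split.
- by apply/finite_setP; eexists; exact: cU.
- by move=> M /unionsP[DC h hM]; have [_ coc _ _] := til _ h; apply: coc.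
- move=> M /unionsP[DC h hM]; have [_ _ s _] := til _ h; have [_ sD _] := desc _ h.
  exact: subset_trans (s M hM) sD.
move=> w pw Lw; have [D dD Dw] := descendants_cover p0 cL pw Lw.
move: dD; rewrite -eD => /mapP[DC h eDC]; rewrite eDC in Dw.
have [_ _ _ ex] := til _ h; have [M [[hM Mw] uM]] := ex w pw Dw.
exists M; split; first by split=> //; apply/unionsP; exists DC.
move=> M' [/unionsP[DC' h' hM'] M'w]; apply: uM; split=> //.
by rewrite (uni _ _ M M' w pw h h' hM hM' Mw M'w).
Qed.

Lemma realizes_tiling s L C : realizes s L C -> tiling L C /\ C #= `I_(leaves s).
Proof.
move: s L C; apply: realizes_ind' => [N L cL iL|p ss L DCs pp cL eD f].
  split; last exact: card_set1.
  split; [exact: finite_set1 | by move=> M -> | by move=> M -> |].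
  by move=> w pw Lw; exists L; split=> // M [->].
apply: (unions_tiling (prime_gt0 pp) cL eD).
by apply: Forall2_impl_in f => s DC _ _ [].
Qed.

Lemma cocyclicT : cocyclic setT.
Proof. by rewrite -(Lam1 (1, 0)); apply: cocyclic_Lam. Qed.

Lemma has_structure_strongly_minimal s C : has_structure s C ->
  strongly_minimal C /\ C #= `I_(leaves s).
Proof.
move=> [_ /realizes_tiling[[fC cC _ ex] cardC]]; split=> //.
by apply: exact_strongly_minimal => // v pv; apply: ex.
Qed.

Definition exact_covering (C : set (set Z2)) : Prop := tiling setT C.

Lemma exact_coveringW C : exact_covering C -> covering C.
Proof.
move=> [fC cC _ ex]; apply: covering_primitive => // [M /cC[]//|w pw].
by have [M [[CM Mw] _]] := ex w pw I; exists M.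
Qed.

Lemma exact_covering_disjoint C M M' w : exact_covering C -> primitive w ->
  C M -> C M' -> M w -> M' w -> M = M'.
Proof.
move=> [_ _ _ ex] pw hM hM' Mw M'w; have [X [_ u]] := ex w pw I.
by rewrite -(u M) // -(u M').
Qed.

Lemma exact_covering_replace C L C' : exact_covering C -> C L -> tiling L C' ->
  exact_covering ((C `\ L) `|` C').
Proof.
move=> eC CL [fC' cC' sC' ex']; have [fC cC _ ex] := eC; split=> //.
- by rewrite finite_setU; split=> //; apply: finite_setD.
- by move=> M [[/cC]|/cC'].
move=> w pw _; have [M [[CM Mw] uM]] := ex w pw I.
case: (pselect (M = L)) => [eM|neM].
  rewrite eM in Mw uM; have [M' [[hM' M'w] uM']] := ex' w pw Mw.
  exists M'; split; first by split=> //; right.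
  by move=> X [[[CX nX]|C'X] Xw]; [case: nX; rewrite /= -(uM X) | exact: uM'].
exists M; split; first by split=> //; left.
move=> X [[[CX _]|C'X] Xw]; first exact: uM.
by case: neM; apply: uM; split=> //; apply: sC' Xw.
Qed.

(** * Realized coverings are refinements *)

Lemma refinement_trans A B C : refinement A B -> refinement B C -> refinement A C.
Proof. by move=> h1 h2; apply: Relation_Operators.rt_trans h1 h2. Qed.

(** The surrounding [C] is arbitrary, so that the induction can work inside a covering already
    partly refined: the descendants replacing [L] are refined in turn, and each replacement leaves
    the covering exact. *)
Lemma realizes_refinement s L C1 : realizes s L C1 -> forall C, exact_covering C -> C L ->
  refinement C ((C `\ L) `|` C1).
Proof.
move: s L C1; apply: realizes_ind' => [N L cL iL|p ss L DCs pp cL eD f] C eC CL.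
  rewrite (_ : _ `|` _ = C); first exact: Relation_Operators.rt_refl.
  apply/seteqP; split=> M; first by case=> [[]|->].
  by move=> CM; case: (pselect (M = L)) => [->|ne]; [right | left].
have p0 := prime_gt0 pp.
have tdesc : tiling L (descendants p L).
  split.
  - by case: eD => _ <-; exact: finite_seq.
  - by move=> M [].
  - by move=> M [].
  move=> w pw Lw; have [D dD Dw] := descendants_cover p0 cL pw Lw.
  exists D; split=> // D' [dD' D'w]; exact: descendants_disjoint dD dD' Dw D'w.
have eC' := exact_covering_replace eC CL tdesc.
set C' := (C `\ L) `|` descendants p L in eC'.
have step : refinement C C'.
  apply: Relation_Operators.rt_step; exists p => //; split=> //; last by exists L.
    exact: exact_coveringW.
  by case: eC.
apply: (refinement_trans step).
have [uD edD] := eD.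
(* No descendant of [L] was already in [C] next to [L]: its primitive vectors would lie in two
   members of an exact covering. *)
have -> : (C `\ L) `|` unions DCs = (C' `\` [set` [seq DC.1 | DC <- DCs]]) `|` unions DCs.
  congr setU; rewrite edD; apply/seteqP; split=> M; last by case=> -[].
  move=> [CM nM]; split; first by left.
  move=> dM; have [w pw Mw] := cocyclic_primitive (let: And3 c _ _ := dM in c).
  apply: nM; apply: (exact_covering_disjoint eC pw CM CL Mw).
  by case: dM => _ s _; apply: s.
have sub : [set` [seq DC.1 | DC <- DCs]] `<=` C' by rewrite edD => M dM; right.
have {}f : List.Forall2 (fun (s : istruct) DC => tiling DC.1 DC.2 /\ forall C, exact_covering C -> C DC.1 ->
    refinement C ((C `\ DC.1) `|` DC.2)) ss DCs.
  by apply: Forall2_impl_in f => s DC _ _ [/realizes_tiling[]].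
elim: f C' eC' uD sub {step eD edD eC CL} => [|s DC ss' DCs' [tDC rDC] _ IH] C' eC' /=.
  by move=> _ _; rewrite setU0 set_nil setD0; exact: Relation_Operators.rt_refl.
move=> /andP[nD uD] sub.
have CD : C' DC.1 by apply: sub; exact: mem_head.
apply: (refinement_trans (rDC C' eC' CD)).
have sub' : [set` [seq DC.1 | DC <- DCs']] `<=` (C' `\ DC.1) `|` DC.2.
  move=> M hM; left; split; first by apply: sub; apply: mem_behead.
  by move=> e; rewrite /= e in hM; rewrite hM in nD.
have eC'' := exact_covering_replace eC' CD tDC.
have := IH _ eC'' uD sub'; congr refinement.
rewrite setUA; congr setU; apply/seteqP; split=> M.
  case=> -[[CM nM]|hM] nMs; last by right.
  left; split=> // hMs; have : M \in DC.1 :: [seq DC.1 | DC <- DCs'] by exact: hMs.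
  by rewrite inE => /orP[/eqP|].
case=> [[CM nM]|hM].
  split; first by left; split=> // e; apply: nM; rewrite e; exact: mem_head.
  by move=> h; apply: nM; apply: mem_behead.
split; first by right.
move=> hMs; have [_ coc s1 _] := tDC; have [w pw Mw] := cocyclic_primitive (coc M hM).
have CM : C' M by apply: sub; apply: mem_behead.
have e := exact_covering_disjoint eC' pw CM CD Mw (s1 M hM w Mw).
by rewrite /= e in hMs; rewrite hMs in nD.
Qed.

Lemma has_structure_refinement s C : has_structure s C -> refinement trivial_covering C.
Proof.
move=> [_ h]; have := realizes_refinement h.
have eT : exact_covering trivial_covering.
  split; [exact: finite_set1 | by move=> M ->; exact: cocyclicT | by [] |].
  by move=> w pw _; exists setT; split=> // M [->].
move=> /(_ _ eT erefl); rewrite (_ : (_ `\ _) `|` _ = C) //.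
by apply/seteqP; split=> M; [case=> // -[] | right].
Qed.

(** * Reading off the index structure from a list of boxes *)

Lemma reps_spec (T U : eqType) (r : T -> T -> bool) (F : T -> U) n s :
  (size s <= n)%N -> {in s &, forall x y, r x y = (F x == F y)} ->
  [/\ {subset reps r n s <= s}, uniq [seq F x | x <- reps r n s] &
      forall x, x \in s -> F x \in [seq F x | x <- reps r n s]].
Proof.
elim: n s => [|n IH] [|x s] //= ls hr.
have hx y : y \in x :: s -> r x y = (F x == F y) by apply: hr; rewrite mem_head.
rewrite hx ?mem_head // eqxx /=.
have [||sub un cov] := IH [seq y <- s | ~~ r x y].
- by rewrite size_filter; apply: leq_trans (count_size _ _) _; rewrite -ltnS.
- by move=> y z; rewrite !mem_filter => /andP[_ ys] /andP[_ zs]; apply: hr; rewrite inE ?ys ?zs orbT.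
split.
- move=> y; rewrite inE => /orP[/eqP->|/sub]; first exact: mem_head.
  by rewrite mem_filter inE => /andP[_ ->]; rewrite orbT.
- rewrite un andbT; apply/mapP => -[y /sub]; rewrite mem_filter => /andP[nxy ys] e.
  by rewrite hx ?inE ?ys ?orbT // e eqxx in nxy.
move=> y; rewrite inE => /orP[/eqP->|ys]; first exact: mem_head.
case E : (r x y); rewrite inE.
  by move: E; rewrite hx ?inE ?ys ?orbT // => /eqP ->; rewrite eqxx.
by rewrite cov ?orbT // mem_filter E.
Qed.

(* [n] is the index of the lattice that the boxes in [c] have replaced. *)
Fixpoint structure_of (k : nat) (n : N) (c : seq box) : option istruct :=
  if k isn't k'.+1 then None else
  if c is [:: b] then if N.eqb b.1 n then Some (Kept (N.to_nat n)) else None else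
  if [seq p <- small_primes | all (fun b : box => divides (n * p)%num b.1) c] is [:: p] then
    let ts := [seq structure_of k' (n * p)%num g
              | g <- group (fun b b' : box => sim (n * p)%num b.2 b'.2) c] in
    if all isSome ts then Some (Refined (pmap id ts)) else None
  else None.

Lemma structure_of_split k n c t : (forall b, c = [:: b] -> b.1 <> n) ->
  structure_of k.+1 n c = Some t ->
  (if [seq p <- small_primes | all (fun b : box => divides (n * p)%num b.1) c] is [:: p] then
    let ts := [seq structure_of k (n * p)%num g
              | g <- group (fun b b' : box => sim (n * p)%num b.2 b'.2) c] in
    if all isSome ts then Some (Refined (pmap id ts)) else None
  else None) = Some t.
Proof.
case: c => [|b [|b' c]] // nb.
have -> : structure_of k.+1 n [:: b] =
  if N.eqb b.1 n then Some (Kept (N.to_nat n)) else None by [].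
by case: N.eqb_spec => // e; case: (nb b).
Qed.

Definition covers (n : nat) (v : Z2) (c : seq box) : Prop :=
  [/\ (0 < n)%N, primitive v,
      forall b, b \in c -> standard b /\ blat b `<=` Lam n v &
      forall w, primitive w -> Lam n v w -> exists2 b, b \in c & blat b w].

Section Node.
Variables (n p : nat) (v : Z2) (c : seq box).
Hypotheses (hc : covers n v c) (pp : prime p).
Hypothesis div : forall b, b \in c -> (n * p %| N.to_nat b.1)%N.
Let n0 : (0 < n)%N. Proof. by case: hc. Qed.
Let pv : primitive v. Proof. by case: hc. Qed.
Let p0 := prime_gt0 pp.
Let np0 : (0 < n * p)%N. Proof. by rewrite muln_gt0 n0. Qed.
Let F (b : box) := Lam (n * p) (zpt b.2).
Let sub (x : box) := [seq b <- c | F x == F b].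

Lemma node_primitive b : b \in c -> primitive (zpt b.2).
Proof. by case: hc => _ _ h _ /h[/standard_primitive]. Qed.

Lemma node_in b : b \in c -> Lam n v (zpt b.2).
Proof. by case: hc => _ _ h _ /h[_]; apply; apply: Lam_refl. Qed.

Lemma node_sub b : b \in c -> blat b `<=` F b.
Proof. by move=> bc; apply: Lam_dvd; exact: div. Qed.

Lemma node_descendant b : b \in c -> descendants p (Lam n v) (F b).
Proof.
move=> bc; apply/descendantsP => //; exists (zpt b.2); split=> //.
  exact: node_primitive.
exact: node_in.
Qed.

Lemma node_eq b w : b \in c -> primitive w -> F b w -> F b = Lam (n * p) w.
Proof. by move=> bc pw h; apply: Lam_eq => //; apply: node_primitive. Qed.

(** Since [c] covers [Lam n v], every descendant holds a box, and a box of index divisible by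
    [n * p] lies in one descendant only. Grouping by [F] thus splits [c] into coverings of the
    descendants. *)
Lemma node_all D : descendants p (Lam n v) D -> exists2 b, b \in c & D = F b.
Proof.
move/descendantsP => []// w [pw vw ->]; have [_ _ _ h] := hc.
have [b bc bw] := h w pw vw; exists b => //.
by rewrite (node_eq bc pw) //; apply: node_sub.
Qed.

Lemma node_covers x : x \in c -> covers (n * p) (zpt x.2) (sub x).
Proof.
move=> xc; have [_ _ h cov] := hc; split=> //; first exact: node_primitive.
  move=> b; rewrite mem_filter => /andP[/eqP e bc]; split; first by case: (h b bc).
  by rewrite -/(F x) e; apply: node_sub.
move=> w pw xw; have vw : Lam n v w.
  apply: (@Lam_trans n v (zpt x.2)); [exact: node_primitive | exact: node_in|].
  by apply: Lam_dvd xw; rewrite dvdn_mulr.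
have [b bc bw] := cov w pw vw; exists b => //; rewrite mem_filter bc andbT; apply/eqP.
by rewrite (node_eq xc pw xw) (node_eq bc pw) //; apply: node_sub.
Qed.
End Node.

Lemma Forall2_pmap (T U : Type) (f : T -> option U) s : all isSome [seq f x | x <- s] ->
  List.Forall2 (fun x u => f x = Some u) s (pmap id [seq f x | x <- s]).
Proof.
elim: s => [|x s IH] //=; case E : (f x) => [u|] //= h; constructor => //.
exact: IH.
Qed.

Lemma group_node n p c : {in c &, forall x y : box,
    sim (n * p)%num x.2 y.2 = (Lam (N.to_nat n * N.to_nat p) (zpt x.2) ==
                               Lam (N.to_nat n * N.to_nat p) (zpt y.2))} ->
  let F (b : box) := Lam (N.to_nat n * N.to_nat p) (zpt b.2) in
  let rs := reps (fun b b' : box => sim (n * p)%num b.2 b'.2) (size c) c in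
  group (fun b b' : box => sim (n * p)%num b.2 b'.2) c =
  [seq [seq y <- c | F x == F y] | x <- rs].
Proof.
move=> h F rs; have [sub _ _] := reps_spec (leqnn (size c)) h.
rewrite /group; apply/eq_in_map => x /sub xc; apply: eq_in_filter => y yc; apply: h => //.
Qed.

Lemma node_sim n p v c : covers n v c -> forall q m, n = N.to_nat m -> p = N.to_nat q ->
  {in c &, forall x y : box,
    sim (m * q)%num x.2 y.2 = (Lam (N.to_nat m * N.to_nat q) (zpt x.2) ==
                               Lam (N.to_nat m * N.to_nat q) (zpt y.2))}.
Proof.
move=> hc q m em eq x y xc yc; rewrite simE to_nat_mul.
have px := node_primitive hc xc; have py := node_primitive hc yc.
by apply/idP/eqP => [h|e]; [exact: Lam_eq | have [] := Lam_inj px py e].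
Qed.

Lemma structure_of_refined k n v c t : covers (N.to_nat n) v c ->
  structure_of k.+1 n c = Some t -> (forall b, c = [:: b] -> b.1 <> n) ->
  exists p ts, [/\ t = Refined ts, p \in small_primes,
    [seq p <- small_primes | all (fun b : box => divides (n * p)%num b.1) c] = [:: p] &
    exists rs, [/\ {subset rs <= c},
      uniq [seq Lam (N.to_nat n * N.to_nat p) (zpt b.2) | b <- rs],
      forall b, b \in c -> Lam (N.to_nat n * N.to_nat p) (zpt b.2) \in
        [seq Lam (N.to_nat n * N.to_nat p) (zpt b.2) | b <- rs] &
      List.Forall2 (fun x t => structure_of k (n * p)%num
          [seq y <- c | Lam (N.to_nat n * N.to_nat p) (zpt x.2) ==
                        Lam (N.to_nat n * N.to_nat p) (zpt y.2)] = Some t) rs ts]].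
Proof.
move=> hc h nb; move: (structure_of_split nb h).
set cand := filter _ small_primes.
case E : cand => [//|p [|//]] {}h.
have pP : p \in small_primes.
  have : p \in cand by rewrite E mem_head.
  by rewrite /cand mem_filter => /andP[].
have hs := node_sim hc (erefl _) (erefl (N.to_nat p)).
move: h; rewrite (group_node hs) -map_comp /=; case: ifP => // /Forall2_pmap f [<-].
have [s1 s2 s3] := reps_spec (leqnn (size c)) hs.
by exists p; eexists; split=> //; exists (reps (fun b b' : box => sim (n * p)%num b.2 b'.2) (size c) c).
Qed.

(** The recursion succeeds only if every group ends in a single box whose index is that of the
    lattice it has to cover; this turns a mere covering into an exact realization. *)
Lemma structure_of_realizes k n v c t : covers (N.to_nat n) v c ->
  structure_of k n c = Some t -> realizes t (Lam (N.to_nat n) v) (cset c).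
Proof.
elim: k n v c t => [//|k IH] n v c t hc.
have [n0 pv hb cov] := hc.
have cL : cocyclic (Lam (N.to_nat n) v) by apply: cocyclic_Lam.
case: (pselect (exists2 b, c = [:: b] & b.1 = n)) => [[b ec eb] /=|nb].
  rewrite ec eb N.eqb_refl => -[<-]; rewrite (_ : cset _ = [set Lam (N.to_nat n) v]).
    by constructor => //; apply/(index_LamT _ n0 pv).
  have bc : b \in c by rewrite ec mem_head.
  have eL : blat b = Lam (N.to_nat n) v.
    rewrite /blat eb; apply: esym; apply: Lam_eq => //; first exact: (node_primitive hc bc).
    exact: (node_in hc bc).
  by apply/seteqP; split=> M; rewrite /cset /= inE eL => /eqP.
move=> ht; have [|p [ts [-> pP candE [rs [rsub rsU rsC f]]]]] := structure_of_refined hc ht.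
  by move=> b ec eb; apply: nb; exists b.
have pp := small_prime pP.
have div b : b \in c -> (N.to_nat n * N.to_nat p %| N.to_nat b.1)%N.
  have : p \in [:: p] by exact: mem_head.
  by rewrite -candE mem_filter => /andP[/allP h _] bc; rewrite -to_nat_mul -dividesE; apply: h.
pose F (b : box) := Lam (N.to_nat n * N.to_nat p) (zpt b.2).
pose sub (x : box) := [seq y <- c | F x == F y].
pose DCs := [seq (F x, cset (sub x)) | x <- rs].
have -> : cset c = unions DCs.
  apply/seteqP; split=> M.
    case/mapP => b bc ->; apply/unionsP.
    have /mapP[x xrs e] := rsC b bc; exists (F x, cset (sub x)); first by apply/mapP; exists x.
    by apply: map_f; rewrite mem_filter bc andbT /F -e.
  case/unionsP => _ /mapP[x _ ->] /mapP[b]; rewrite mem_filter => /andP[_ bc] ->.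
  exact: map_f.
apply: (@realizes_refined (N.to_nat p) _ [seq DC.1 | DC <- DCs]) => //.
  rewrite -map_comp; split=> //.
  apply/seteqP; split=> D.
    by case/mapP => x xrs ->; apply: (node_descendant hc pp); exact: rsub.
  by move=> /(node_all hc pp div)[b bc ->]; exact: rsC.
apply: realizes_allP; rewrite /DCs.
elim: f rsub {rsU rsC DCs ht} => [|x t' rs' ts' hx _ IHf] rsub /=; constructor.
  have := IH (n * p)%num (zpt x.2) (sub x) t'; rewrite to_nat_mul; apply=> //.
  by apply: (node_covers hc pp div); apply: rsub; exact: mem_head.
by apply: IHf => y ys; apply: rsub; rewrite inE ys orbT.
Qed.

(** A realization that splits [L] at [p] makes [n * p] divide all indices, so [p] is a candidate of
    [structure_of], which accepts only a single one. Both splittings therefore use the same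
    descendants, and the groups are the parts of [C] below them. *)
Lemma structure_of_unique s L C : realizes s L C -> forall k n v c t,
  L = Lam (N.to_nat n) v -> C = cset c -> covers (N.to_nat n) v c ->
  structure_of k n c = Some t -> same_struct s t.
Proof.
move: s L C; apply: realizes_ind' => [N L cL iL|p ss L DCs pp cL [uD eD] f] [//|k] n v c t eL eC hc ht;
  have [n0 pv hb cov] := hc.
  have bE b : b \in c -> b.1 = n /\ blat b = L.
    move=> bc; have [sb _] := hb b bc.
    have : cset c (blat b) by apply: map_f.
    rewrite -eC => e; split=> //; rewrite eL in e.
    by have [/N2Nat.inj] := Lam_inj (standard_primitive sb) pv e.
  rewrite eL in iL; have eN := (index_LamT _ n0 pv).1 iL.
  case: (pselect (exists2 b, c = [:: b] & b.1 = n)) => [[b ec eb]|nb].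
    by move: ht; rewrite /= ec eb N.eqb_refl => -[<-]; rewrite eN; constructor.
  (* Every box here is [L] itself, of index [n], whereas a split at [p] would make [n * p] divide
     that index. *)
  have [|p [ts [_ pP candE _]]] := structure_of_refined hc ht.
    by move=> b ec eb; apply: nb; exists b.
  have [b bc _] := cov v pv (Lam_refl _ _).
  have : p \in [:: p] by exact: mem_head.
  rewrite -candE mem_filter => /andP[/allP/(_ b bc) + _].
  rewrite dividesE to_nat_mul; have [-> _] := bE b bc => /dvdn_leq; rewrite n0 => /(_ isT).
  by rewrite leqNgt ltn_Pmulr // prime_gt1 // small_prime.
have p0 := prime_gt0 pp.
have desc DC : DC \in DCs -> descendants p L DC.1 by move=> h; rewrite -eD; apply: map_f.
have real DC : DC \in DCs -> exists s, realizes s DC.1 DC.2.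
  by elim: f {uD eD eC desc} => // s1 DC1 ss1 DCs1 [h _] _ IH; rewrite inE => /orP[/eqP->|]; [exists s1|].
have box_of b : b \in c -> exists2 DC, DC \in DCs & DC.2 (blat b).
  by move=> bc; apply/unionsP; rewrite eC; apply: map_f.
have inD DC M : DC \in DCs -> DC.2 M -> M `<=` DC.1.
  by move=> h hM; have [s0 /realizes_tiling[[_ _ hs _] _]] := real DC h; apply: hs.
have div b : b \in c -> (N.to_nat n * p %| N.to_nat b.1)%N.
  move=> bc; have [DC h hM] := box_of b bc; have := inD DC _ h hM.
  have := desc DC h; rewrite eL => /descendantsP[]// w [pw _ ->].
  by move/(Lam_subP (standard_primitive (hb b bc).1) pw) => [].
have [b0 b0c _] := cov v pv (Lam_refl _ _).
have [q qP eq] : exists2 q, q \in small_primes & N.to_nat q = p.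
  have [[_ _ _ h] _] := hb b0 b0c; apply: h => //.
  exact: dvdn_trans (dvdn_mull _ _) (div b0 b0c).
have [|q' [ts [et q'P candE [rs [rsub rsU rsC g]]]]] := structure_of_refined hc ht.
  move=> b ec eb; have := div b; rewrite ec mem_head eb => /(_ isT) /dvdn_leq; rewrite n0 => /(_ isT).
  by rewrite leqNgt ltn_Pmulr // prime_gt1.
have qq : q = q'.
  have : q \in [:: q'] by rewrite -candE mem_filter qP andbT; apply/allP => b bc; rewrite dividesE to_nat_mul eq div.
  by rewrite inE => /eqP.
rewrite -qq eq in rsU rsC g; rewrite et.
pose F (b : box) := Lam (N.to_nat n * p) (zpt b.2).
have pm : perm_eq [seq DC.1 | DC <- DCs] [seq F b | b <- rs].
  apply: uniq_perm => // D; apply/idP/idP => hD.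
    have : descendants p L D by rewrite -eD.
    by rewrite eL => /(node_all hc pp div)[b bc ->]; exact: rsC.
  have : [set` [seq DC.1 | DC <- DCs]] D; last by [].
  by rewrite eD eL; case/mapP: hD => b /rsub bc ->; exact: (node_descendant hc pp).
have := perm_Permutation pm => /Permutation.Permutation_sym/Permutation.Permutation_map_inv.
case=> DCs' [eDCs' pD].
have pD' : DCs' =i DCs by move=> x; apply/esym/perm_mem/Permutation_perm.
have [ss' [ps fs]] := Forall2_perm f pD.
apply: (same_refined ps).
have key DC x : DC \in DCs -> x \in rs -> DC.1 = F x -> DC.2 = cset [seq y <- c | F x == F y].
  move=> h xrs e; apply/seteqP; split=> M.
    move=> hM; have : unions DCs M by apply/unionsP; exists DC.
    rewrite eC => /mapP[b bc eM]; rewrite eM in hM *.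
    apply: map_f; rewrite mem_filter bc andbT; apply/eqP.
    apply: (node_eq hc (rsub x xrs)); first exact: (node_primitive hc bc).
    by rewrite -/(F x) -e; apply: (inD _ _ h hM); apply: Lam_refl.
  case/mapP => b; rewrite mem_filter => /andP[/eqP eF bc] ->.
  have [DC' h' hM'] := box_of b bc.
  suff <- : DC' = DC by [].
  have e' : DC'.1 = DC.1.
    apply: (descendants_disjoint p0 cL (node_primitive hc bc) (desc _ h') (desc _ h)).
      by apply: (inD _ _ h' hM'); apply: Lam_refl.
    by rewrite e eF; apply: Lam_refl.
  apply/eqP; rewrite -(nth_index DC h) -(nth_index DC h').
  suff -> : index DC' DCs = index DC DCs by [].
  apply/eqP; rewrite -(nth_uniq DC.1 _ _ uD) ?size_map ?index_mem //.
  by rewrite !(nth_map DC) ?index_mem // !nth_index // e'.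
have sub1 : {subset DCs' <= DCs} by move=> x; rewrite pD'.
elim: g ss' DCs' eDCs' fs rsub sub1 key {pD pD' ps pm rsU rsC et ht} =>
  [|x t1 rs1 ts1 hx _ IHg] ss' [|DC DCs'] //= e1 fs rsub sub1 key;
  inversion fs as [|s1 DC1 ss1 DCs1 [_ Px] fs']; subst; constructor.
  case: e1 => e1 _; have DCin : DC \in DCs by apply: sub1; exact: mem_head.
  have xin : x \in x :: rs1 by exact: mem_head.
  apply: (Px k (n * q')%num (zpt x.2) [seq y <- c | F x == F y]).
  - by rewrite to_nat_mul -e1.
  - exact: key.
  - by rewrite to_nat_mul; apply: (node_covers hc pp div); exact: rsub.
  - exact: hx.
case: e1 => _ e1; apply: (IHg _ DCs') => //.
- by move=> y ys; apply: rsub; rewrite inE ys orbT.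
- by move=> y ys; apply: sub1; rewrite inE ys orbT.
- by move=> DC' y h ys; apply: key => //; rewrite inE ys orbT.
Qed.

(** * The classification *)

Lemma all_In (T : Type) (p : pred T) s x : all p s -> List.In x s -> p x.
Proof. by elim: s => //= y s IH /andP[py ps] [<-|/IH]; auto. Qed.

Lemma has_In (T : Type) (p : pred T) s : has p s <-> exists2 x, List.In x s & p x.
Proof.
elim: s => [|y s IH] /=; first by split=> // -[].
split=> [/orP[py|/IH[x xs px]]|[x [<-|xs] px]].
- by exists y; [left|].
- by exists x; [right|].
- by rewrite px.
- by apply/orP; right; apply/IH; exists x.
Qed.

Fixpoint remove_first (T : Type) (p : pred T) (s : seq T) : option (seq T) :=
  if s is x :: s' then
    if p x then Some s' else omap (cons x) (remove_first p s')
  else None.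

Lemma remove_firstP (T : Type) (p : pred T) s s' : remove_first p s = Some s' ->
  exists2 x, p x & Permutation.Permutation (x :: s') s.
Proof.
elim: s s' => [|x s IH] s' //=; case: ifP => [px [<-]|_].
  by exists x => //; apply: Permutation.Permutation_refl.
case E : (remove_first p s) => [u|] // [<-]; have [y py h] := IH u E.
exists y => //; apply: Permutation.perm_trans (Permutation.perm_swap _ _ _) _.
exact: Permutation.perm_skip.
Qed.

Fixpoint same_structb (s t : istruct) {struct s} : bool :=
  match s, t with
  | Kept m, Kept n => m == n
  | Refined ss, Refined ts =>
      (fix match_all ss ts := match ss with
        | [::] => nilp ts
        | s' :: ss' =>
            if remove_first (same_structb s') ts is Some ts' then match_all ss' ts' else false
        end) ss ts
  | _, _ => false
  end.

(** Matching is greedy: each success removes one entry of [ts], and the removed entries, in order,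
    form the required permutation. *)
Lemma same_structbW s t : same_structb s t -> same_struct s t.
Proof.
elim/istruct_ind': s t => [m|ss IH] [n|ts] //=; first by move=> /eqP ->; constructor.
move=> h; suff [ts' p f] : exists2 ts', Permutation.Permutation ts' ts & List.Forall2 same_struct ss ts'.
  by have [ss' [q f']] := Forall2_perm f p; exact: same_refined q f'.
elim: ss ts IH h => [|s ss IHss] ts IH.
  by move=> /nilP ->; exists [::]; constructor.
case E : (remove_first _ ts) => [u|] // h; have [t st p] := remove_firstP E.
have [|ts' q f] := IHss u _ h; first by move=> s' hs'; apply: IH; right.
exists (t :: ts'); first exact: Permutation.perm_trans (Permutation.perm_skip _ q) p.
by constructor => //; apply: IH => //; left.
Qed.

(* Invariant under reordering the entries, and injective on the structures in the
   tables up to reordering. *)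
Fixpoint hash (s : istruct) : N :=
  match s with
  | Kept n => N.of_nat n
  | Refined ss => foldr (fun t h => ((hash t + 5) * (hash t + 5) + h)%num) 0%num ss
  end.

Lemma same_struct_hash s t : same_struct s t -> hash s = hash t.
Proof.
elim/istruct_ind': s t => [m|ss IH] t h; inversion h as [|? ss' ss'' p f]; subst => //=.
have -> : foldr (fun t h => ((hash t + 5) * (hash t + 5) + h)%num) 0%num ss =
          foldr (fun t h => ((hash t + 5) * (hash t + 5) + h)%num) 0%num ss'.
  elim: p {IH h f} => //= [x s s' _ ->|x y s|s s' u _ -> _ ->] //.
  by rewrite !N.add_assoc; congr N.add; rewrite N.add_comm.
have {}IH s : List.In s ss' -> forall t, same_struct s t -> hash s = hash t.
  by move=> hs; apply: IH; apply: Permutation.Permutation_in hs; exact: Permutation.Permutation_sym.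
elim: f IH {p h} => //= x y s s' hxy _ IHf IH; rewrite (IH x _ y) ?IHf //; last by left.
by move=> z hz; apply: IH; right.
Qed.

(** Fuel 8 suffices: the deepest nesting has seven levels, for the indices 1, 2, 4 and so on up to
    64. *)
Definition shape (c : seq box) : option istruct := structure_of 8 1%num c.
Definition overlapping (c : seq box) : bool :=
  has (fun w => (1 < count (fun b : box => sim b.1 b.2 w) c)%N) grid.

(** A computed dichotomy: an entry either has a structure or has a primitive vector in two of its
    lattices, which refutes strong minimality; the latter occurs only above size 6. *)
Lemma table_shapes : all (fun c => if shape c is Some _ then true else
   (6 < size c)%N && overlapping c) table.
Proof. by vm_cast_no_check (erefl true). Qed.

Lemma table_covers c : c \in table -> covers (N.to_nat 1) (1, 0) c.
Proof.
move=> hc; have [[cov _] std] := table_minimal hc; split=> //.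
  by move=> b /std sb; split=> //; rewrite Lam1.
move=> w _ _; have [L /mapP[b bc ->] bw] := coveringE w cov.
by exists b.
Qed.

Lemma shape_has_structure c t : c \in table -> shape c = Some t -> has_structure t (cset c).
Proof.
move=> hc ht; split; first by case: (table_minimal hc) => -[].
by have := structure_of_realizes (table_covers hc) ht; rewrite Lam1.
Qed.

Lemma shape_unique c s t : c \in table -> shape c = Some t -> has_structure s (cset c) ->
  same_struct s t.
Proof.
move=> hc ht [_ hs]; apply: (structure_of_unique hs _ erefl (table_covers hc) ht).
by rewrite Lam1.
Qed.

Lemma strongly_minimal_shape c : c \in table -> strongly_minimal (cset c) <-> isSome (shape c).
Proof.
move=> hc; split=> [[_ ex]|].
  have := allP table_shapes c hc; case: (shape c) => // /andP[_ /hasP[w wg]].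
  have [L [_ uL]] := ex _ (grid_primitive wg).
  rewrite ltnNge => /negP[]; apply: (count_uniq_le1 (f := blat) (y := L)).
    exact: table_coverings_uniq.
  by move=> b bc; rewrite simE => hb; apply/esym/uL; split=> //; exact: map_f.
by case E : (shape c) => [t|] // _; have [] := has_structure_strongly_minimal (shape_has_structure hc E).
Qed.

Lemma strongly_minimal_of_sizeP n C : (n <= 8)%N -> strongly_minimal_of_size n C <->
  exists c, [/\ c \in table, (size c == n) && isSome (shape c) & C = cset c].
Proof.
move=> n8; split=> [[sC Cn]|[c [hc /andP[/eqP sc hs] ->]]].
  have [c [hc sc eC]] := (minimal_of_sizeP C n8).1 (conj sC.1 Cn).
  exists c; split=> //; rewrite sc eqxx /=; apply/(strongly_minimal_shape hc).
  by rewrite -eC.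
by split; [exact/strongly_minimal_shape | rewrite -sc cset_card].
Qed.

Lemma not_strongly_minimal_of_sizeP n C : (n <= 8)%N -> not_strongly_minimal_of_size n C <->
  exists c, [/\ c \in table, (size c == n) && ~~ isSome (shape c) & C = cset c].
Proof.
move=> n8; split=> [[mC nC Cn]|[c [hc /andP[/eqP sc hs] ->]]].
  have [c [hc sc eC]] := (minimal_of_sizeP C n8).1 (conj mC Cn).
  exists c; split=> //; rewrite sc eqxx /=; apply/negP => h.
  by apply: nC; rewrite eC; apply/strongly_minimal_shape.
have [mc _] := table_minimal hc; split=> //; last by rewrite -sc cset_card.
by move=> /(strongly_minimal_shape hc); apply/negP.
Qed.

Definition shapes (n : nat) : seq istruct := pmap shape [seq c <- table | size c == n].

(** Hashes select the pairs worth comparing, and [same_structb] confirms each coincidence. A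
    positive multiplicity ensures that a listed structure occurs. *)
Definition classifies (n : nat) (S : seq istruct) (T : seq (istruct * nat)) : bool :=
  let SH := [seq (s, hash s) | s <- S] in
  let TH := [seq (e, hash e.1) | e <- T] in
  all (fun x => has (fun y => N.eqb x.2 y.2) TH) SH &&
  all (fun y => [&& all (fun x => N.eqb x.2 y.2 ==> same_structb x.1 y.1.1) SH,
                    count (fun x => N.eqb x.2 y.2) SH == y.1.2, (0 < y.1.2)%N &
                    leaves y.1.1 == n]) TH.

(** Multiplicities count all coverings with a structure, whether or not they are known to lie in
    [F]. Such a covering is strongly minimal of size [leaves], hence in [table], and equal hashes
    have been checked to mean equal structures. *)
Lemma classifies_structures n F T : (n <= 8)%N ->
  (forall C, F C <-> exists c, [/\ c \in table, (size c == n) && isSome (shape c) & C = cset c]) ->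
  classifies n (shapes n) T -> classified_by_structure F T.
Proof.
move=> n8 hF; rewrite /classifies !all_map => /andP[h1 h2].
have shP s : List.In s (shapes n) <-> exists c, [/\ c \in table, size c = n & shape c = Some s].
  rewrite /shapes; elim: table => [|c l IH] /=; first by split=> // -[c []].
  split.
    case: eqP => [sc|_] /=; last first.
      by move/IH => [c' [h h' h'']]; exists c'; rewrite inE h orbT.
    case E : (shape c) => [t|] /=; first case=> [<-|]; first by exists c; rewrite mem_head.
      by move/IH => [c' [h h' h'']]; exists c'; rewrite inE h orbT.
    by move/IH => [c' [h h' h'']]; exists c'; rewrite inE h orbT.
  case=> c' []; rewrite inE => /orP[/eqP-> -> e|h h' h''].
    by rewrite eqxx /= e /=; left.
  have hin : List.In s (pmap shape [seq c <- l | size c == n]) by apply/IH; exists c'.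
  by case: eqP => //= _; case: (shape c) => //= t; right.
have eqs s e : List.In s (shapes n) -> List.In e T -> hash s = hash e.1 -> same_struct s e.1.
  move=> hs he h; have /= /andP[+ _] := all_In h2 he; rewrite all_map => hall.
  by have /= := all_In hall hs; rewrite h N.eqb_refl => /same_structbW.
split.
- move=> C /hF[c [hc /andP[_ +] ->]]; case E : (shape c) => [t|] // _.
  by exists t; apply: shape_has_structure.
- move=> s; split.
    case=> C /hF[c [hc /andP[/eqP sc +] ->]]; case E : (shape c) => [t|] // _ hs.
    have tS : List.In t (shapes n) by apply/shP; exists c.
    have := all_In h1 tS; rewrite /= has_map => /has_In[e he /N.eqb_eq /= eh].
    by exists e => //; apply: same_struct_trans (shape_unique hc E hs) (eqs _ _ tS he eh).
  case=> e he hse; have /= /and4P[_ /eqP cnt pos _] := all_In h2 he.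
  have : has (fun x => N.eqb x.2 (hash e.1)) [seq (s, hash s) | s <- shapes n].
    by rewrite has_count cnt.
  rewrite has_map => /has_In[t tS /N.eqb_eq /= eh]; have hte := eqs _ _ tS he eh.
  have /shP[c [hc sc E]] := tS; exists (cset c).
    by apply/hF; exists c; rewrite sc E eqxx.
  have [cov hr] := shape_has_structure hc E; split=> //.
  by apply: same_struct_realizes hr; apply: same_struct_trans hte (same_struct_sym hse).
move=> e he; have /= /and4P[_ /eqP cnt _ /eqP lv] := all_In h2 he.
have <- : count (fun c => (size c == n) && (if shape c is Some t then N.eqb (hash t) (hash e.1) else false)) table = e.2.
  rewrite -cnt count_map /shapes; elim: table => //= c l ->.
  by case: eqP => //= _; case: (shape c).
apply: card_table_set => C; split.
  move=> hC; have [sC] := has_structure_strongly_minimal hC; rewrite lv => Cn.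
  have [c [hc /andP[sc +] eC]] := (strongly_minimal_of_sizeP C n8).1 (conj sC Cn).
  case E : (shape c) => [t|] // _; exists c; split=> //; rewrite sc /= E.
  by rewrite eC in hC; apply/N.eqb_eq/esym/same_struct_hash/(shape_unique hc E hC).
case=> c [hc /andP[/eqP sc +] ->]; case E : (shape c) => [t|] // /N.eqb_eq eh.
have tS : List.In t (shapes n) by apply/shP; exists c.
have [cov hr] := shape_has_structure hc E; split=> //.
exact: same_struct_realizes (eqs _ _ tS he eh) hr.
Qed.

(** * Index sequences of the coverings that are not strongly minimal *)

Definition indices (c : seq box) : seq nat := [seq N.to_nat b.1 | b <- c].

Lemma has_index_sequenceP c t : c \in table ->
  has_index_sequence t (cset c) <-> perm_eq t (indices c).
Proof.
move=> hc; have [_ std] := table_minimal hc.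
have ind b : b \in c -> forall i, index_is setT (blat b) i <-> N.to_nat b.1 = i.
  by move=> bc i; have [_ _ b0 _] := std b bc; apply: index_LamT b0 (standard_primitive (std b bc)).
split=> [[Ls [uLs eLs] f]|].
  have pm : perm_eq Ls [seq blat b | b <- c].
    apply: uniq_perm => //; first exact: table_coverings_uniq.
    have e : [set` Ls] = [set` [seq blat b | b <- c]] by exact: eLs.
    move=> L; apply/idP/idP => h.
      by have : [set` Ls] L by []; rewrite e.
    by have : [set` [seq blat b | b <- c]] L by []; rewrite -e.
  have /Permutation.Permutation_map_inv[c' [eL pc]] := perm_Permutation pm.
  have pc' := Permutation_perm pc.
  suff -> : t = indices c' by rewrite perm_sym; apply: perm_map.
  have sub : {subset c' <= c} by move=> b; rewrite (perm_mem pc').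
  rewrite eL in f; elim: c' t f sub {eL pc pc'} => [|b c' IH] t f sub; inversion f as [|? i ? t' hi hf]; subst => //=.
  congr (_ :: _); first by apply/esym/(ind b); rewrite ?sub ?mem_head.
  by apply: IH => // b' hb'; apply: sub; rewrite inE hb' orbT.
move=> /perm_Permutation/Permutation.Permutation_map_inv[c' [-> pc]].
have pc' := Permutation_perm pc.
exists [seq blat b | b <- c'].
  split; first by rewrite -(perm_uniq (perm_map blat pc')) table_coverings_uniq.
  by apply/seteqP; split=> L; rewrite /cset /= (perm_mem (perm_map blat pc')).
have sub : {subset c' <= c} by move=> b; rewrite (perm_mem pc').
elim: c' sub {pc pc'} => [|b c' IH] sub /=; constructor.
  by apply/ind => //; apply: sub; exact: mem_head.
by apply: IH => b' hb'; apply: sub; rewrite inE hb' orbT.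
Qed.

Definition irregular (n : nat) : seq (seq box) :=
  [seq c <- table | (size c == n) && ~~ isSome (shape c)].
Definition classifies_indices (S : seq (seq nat)) (T : seq (seq nat * nat)) : bool :=
  all (fun s => has (fun e => perm_eq s e.1) T) S &&
  all (fun e => (count (fun s => perm_eq s e.1) S == e.2) && (0 < e.2)%N) T.

Lemma classifies_index_sequences n T : (n <= 8)%N ->
  classifies_indices [seq indices c | c <- irregular n] T ->
  classified_by_indices (not_strongly_minimal_of_size n) T.
Proof.
rewrite /classifies_indices => n8 /andP[/allP h1 /allP h2].
have irrP C : not_strongly_minimal_of_size n C <-> exists2 c, c \in irregular n & C = cset c.
  split=> [/(not_strongly_minimal_of_sizeP _ n8)[c [hc hs ->]]|[c + ->]].
    by exists c; rewrite // mem_filter hs.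
  rewrite mem_filter => /andP[hs hc]; apply/(not_strongly_minimal_of_sizeP _ n8).
  by exists c.
have tab c : c \in irregular n -> c \in table by rewrite mem_filter => /andP[].
split.
- move=> C /irrP[c hc ->]; exists (indices c); apply/has_index_sequenceP; last exact: perm_refl.
  exact: tab.
- move=> t; split.
    case=> C /irrP[c hc ->] /(has_index_sequenceP _ (tab c hc)) ht.
    have /hasP[e eT he] := h1 _ (map_f indices hc).
    by exists e => //; apply: perm_trans he.
  case=> e eT te; have /andP[/eqP cnt pos] := h2 e eT.
  have : has (fun s => perm_eq s e.1) [seq indices c | c <- irregular n] by rewrite has_count cnt.
  case/hasP => _ /mapP[c hc ->] he; exists (cset c); first by apply/irrP; exists c.
  by apply/(has_index_sequenceP _ (tab c hc)); rewrite (perm_trans te) // perm_sym.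
move=> e eT; have /andP[/eqP <- _] := h2 e eT.
have -> : count (fun s => perm_eq s e.1) [seq indices c | c <- irregular n] =
  count (fun c => perm_eq (indices c) e.1 && ((size c == n) && ~~ isSome (shape c))) table.
  by rewrite count_map count_filter.
apply: card_table_set => C; split.
  case=> /irrP[c hc ->] /(has_index_sequenceP _ (tab c hc)) he; exists c; split=> //; first exact: tab.
  by rewrite perm_sym he; move: hc; rewrite mem_filter => /andP[].
case=> c [hc /andP[he hs] ->]; split; first by apply/irrP; exists c; rewrite // mem_filter hs.
by apply/(has_index_sequenceP _ hc); rewrite perm_sym.
Qed.

Lemma table_counts :
  [&& count (fun c => size c <= 6)%N table == 55%N,
      count (fun c => size c == 7%N) table == 144%N,
      count (fun c => (size c == 7%N) && isSome (shape c)) table == 126%N,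
      count (fun c => (size c == 7%N) && ~~ isSome (shape c)) table == 18%N,
      count (fun c => size c == 8%N) table == 724%N,
      count (fun c => (size c == 8%N) && isSome (shape c)) table == 550%N &
      count (fun c => (size c == 8%N) && ~~ isSome (shape c)) table == 174%N].
Proof. by vm_cast_no_check (erefl true). Qed.

Lemma table_structures :
  all (fun n => classifies n (shapes n) (structures_up_to_6 n)) (iota 0 7) &&
  (classifies 7 (shapes 7) structures_7 && classifies 8 (shapes 8) structures_8).
Proof. by vm_cast_no_check (erefl true). Qed.

Lemma table_indices :
  classifies_indices [seq indices c | c <- irregular 7] index_sequences_7 &&
  classifies_indices [seq indices c | c <- irregular 8] index_sequences_8.
Proof. by vm_cast_no_check (erefl true). Qed.

Lemma small_shape c : c \in table -> (size c <= 6)%N -> isSome (shape c).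
Proof.
by move=> hc sc; have := allP table_shapes c hc; case: (shape c) => //; rewrite ltnNge sc.
Qed.

Local Close Scope ring_scope.

Theorem theoremC :
  [/\ [/\ [set C | exists2 n, n <= 6 & minimal_of_size n C] #= `I_55,
          forall n C, n <= 6 -> minimal_of_size n C ->
            strongly_minimal C /\ refinement trivial_covering C
        & forall n, n <= 6 ->
            classified_by_structure (minimal_of_size n)
              (structures_up_to_6 n)],
      [/\ minimal_of_size 7 #= `I_144,
          strongly_minimal_of_size 7 #= `I_126,
          not_strongly_minimal_of_size 7 #= `I_18,
          classified_by_structure (strongly_minimal_of_size 7) structures_7
        & classified_by_indices (not_strongly_minimal_of_size 7)
            index_sequences_7]
    & [/\ minimal_of_size 8 #= `I_724,
          strongly_minimal_of_size 8 #= `I_550,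
          not_strongly_minimal_of_size 8 #= `I_174,
          classified_by_structure (strongly_minimal_of_size 8) structures_8
        & classified_by_indices (not_strongly_minimal_of_size 8)
            index_sequences_8]].
Proof.
have le8 n : n <= 6 -> n <= 8 by move=> h; apply: leq_trans h _.
have minimalE n C : n <= 8 -> minimal_of_size n C <->
    exists c, [/\ c \in table, size c == n & C = cset c].
  move=> n8; split=> [/(minimal_of_sizeP C n8)[c [hc sc ->]]|[c [hc /eqP sc ->]]].
    by exists c; rewrite sc.
  by apply/(minimal_of_sizeP _ n8); exists c.
split.
- split.
  + have /and5P[/eqP <- _ _ _ _] := table_counts; apply: card_table_set => C; split.
      by case=> n n6 /(minimalE n C (le8 n n6))[c [hc /eqP sc ->]]; exists c; rewrite sc.
    by case=> c [hc sc ->]; exists (size c) => //; apply/(minimalE _ _ (le8 _ sc)); exists c.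
  + move=> n C n6 /(minimalE n C (le8 n n6))[c [hc /eqP sc ->]]; rewrite -sc in n6.
    have := small_shape hc n6; case E : (shape c) => [t|] // _.
    have hs := shape_has_structure hc E.
    by split; [case: (has_structure_strongly_minimal hs) | exact: has_structure_refinement hs].
  + move=> n n6; apply: (@classifies_structures n); first exact: le8.
      (* Up to size 6 every entry has a structure, so the strongly minimal family is the whole
         minimal one. *)
      move=> C; split=> [/(minimalE n C (le8 n n6))[c [hc /eqP sc ->]]|[c [hc /andP[sc _] ->]]].
        by exists c; split=> //; rewrite sc eqxx small_shape // sc.
      by apply/(minimalE n _ (le8 n n6)); exists c.
    by case/andP: table_structures => /allP str6 _; apply: str6; rewrite mem_iota.
- split.
  + have /and5P[_ /eqP <- _ _ _] := table_counts; apply: card_table_set => C; exact: minimalE.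
  + have /and5P[_ _ /eqP <- _ _] := table_counts.
    by apply: card_table_set => C; exact: strongly_minimal_of_sizeP.
  + have /and5P[_ _ _ /eqP <- _] := table_counts.
    by apply: card_table_set => C; exact: not_strongly_minimal_of_sizeP.
  + apply: (@classifies_structures 7); first by [].
      by move=> C; exact: strongly_minimal_of_sizeP.
    by case/and3P: table_structures.
  + apply: (@classifies_index_sequences 7); first by [].
    by case/andP: table_indices.
split.
- have /and5P[_ _ _ _ /and3P[/eqP <- _ _]] := table_counts; apply: card_table_set => C; exact: minimalE.
- have /and5P[_ _ _ _ /and3P[_ /eqP <- _]] := table_counts.
  by apply: card_table_set => C; exact: strongly_minimal_of_sizeP.
- have /and5P[_ _ _ _ /and3P[_ _ /eqP <-]] := table_counts.
  by apply: card_table_set => C; exact: not_strongly_minimal_of_sizeP.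
- apply: (@classifies_structures 8); first by [].
    by move=> C; exact: strongly_minimal_of_sizeP.
  by case/and3P: table_structures.
- apply: (@classifies_index_sequences 8); first by [].
  by case/andP: table_indices.
Qed.
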